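(* There is an absolute constant $C_0>0$ such that the following holds for all numerical constants $c_1,c_2\ge C_0$ and every numerical constant $c_s\ge 5c_1$. Let $n,d,s$ be positive integers with $d/s\ge 3$, let $L,\sigma>0$, $\delta\in(0,1)$, and let $\boldsymbol\beta^*\in\mathbb{R}^d$ have exactly $s$ nonzero entries. Let $y_i=\mathbf{x}_i^\top\boldsymbol\beta^*+\xi_i$ for $i=1,\dots,n$, where: (i) $\{\mathbf{x}_i\}_{i=1}^n$ are i.i.d. copies of an $L$-subexponential random vector in $\mathbb{R}^d$ with $\mathbb{E}\mathbf{x}_i=0$ and $\mathbb{E}\mathbf{x}_i\mathbf{x}_i^\top=I$; (ii) $\{\xi_i\}_{i=1}^n$ are i.i.d. random variables with $\mathbb{E}\xi_i^2\le\sigma^2$; and $\{\mathbf{x}_i\}_{i=1}^n$ is independent of $\{\xi_i\}_{i=1}^n$. Set $$r_{d,s}=\sqrt{\frac{s\log(d/s)}{n}},\qquad r_\delta=\sqrt{\frac{\log(1/\delta)}{n}}.$$ Suppose that the tuning parameters $\lambda_o,\lambda_s>0$ satisfy $$\lambda_o\sqrt n\ \ge\ 576\,\sigma L^2,\qquad \lambda_s\sqrt s= c_s\,\lambda_o\sqrt n\,L\,(r_{d,s}+r_\delta),$$ let $$r_2=5L\lambda_o\sqrt n\,(c_1+c_2+c_s)(r_{d,s}+r_\delta),\qquad r_1=3\sqrt s\,r_2,$$ and suppose that $n$ is large enough that $$1\ \ge\ \max\left\{r_{d,s},\ r_\delta,\ r_2,\ 320L^4(c_1+c_2+c_s)(r_{d,s}+r_\delta)\right\}.$$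 Then, with probability at least $1-2\delta$, the optimal solution $$\hat{\boldsymbol\beta}\in\operatorname*{arg\,min}_{\boldsymbol\beta\in\mathbb{R}^d}\left\{\sum_{i=1}^n\lambda_o^2\,H\!\left(\frac{y_i-\mathbf{x}_i^\top\boldsymbol\beta}{\lambda_o\sqrt n}\right)+\lambda_s\|\boldsymbol\beta\|_1\right\}$$ satisfies $$\|\hat{\boldsymbol\beta}-\boldsymbol\beta^*\|_1\le r_1,\qquad \|\hat{\boldsymbol\beta}-\boldsymbol\beta^*\|_2\le r_2.$$
   Context: $\|\cdot\|_1,\|\cdot\|_2$ are the usual $\ell_1$ and $\ell_2$ norms on $\mathbb{R}^d$. The Huber loss is $H(t)=|t|-1/2$ if $|t|>1$ and $H(t)=t^2/2$ if $|t|\le1$. For a random variable $f$ and $\alpha>0$, $\|f\|_{\psi_\alpha}:=\inf\{\eta>0:\ \mathbb{E}\exp(|f/\eta|^\alpha)\le 2\}$. A random vector $\mathbf{x}\in\mathbb{R}^d$ is called $L$-subexponential if for every fixed $\mathbf{v}\in\mathbb{R}^d$, $\|\langle\mathbf{x}-\mathbb{E}\mathbf{x},\mathbf{v}\rangle\|_{\psi_1}\le L\left(\mathbb{E}\langle\mathbf{x}-\mathbb{E}\mathbf{x},\mathbf{v}\rangle^2\right)^{1/2}$. A numerical (absolute) constant does not depend on $n,d,s,L,\sigma,\delta,\lambda_o,\lambda_s$ or on the distributions of the data. *)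

(* Defs.v *)
From HB Require Import structures.
From mathcomp Require Import all_boot all_order all_algebra.
From mathcomp Require Import all_classical all_reals all_analysis.

Set Implicit Arguments.
Unset Strict Implicit.
Unset Printing Implicit Defensive.

Import Order.TTheory GRing.Theory Num.Theory.
Import numFieldNormedType.Exports.

Local Open Scope classical_set_scope.
Local Open Scope ring_scope.

Section vectors.
Context {R : realType} {d : nat}.
Implicit Types u v : 'rV[R]_d.

(* Random vectors take values in d.-tuple R, which carries the product
   sigma-algebra; linear algebra is done in 'rV[R]_d. *)
Definition vec (x : d.-tuple R) : 'rV[R]_d := \row_j tnth x j.

Definition inner u v : R := \sum_j u 0 j * v 0 j.
Definition norm1 v : R := \sum_j `|v 0 j|.
Definition norm2 v : R := Num.sqrt (\sum_j v 0 j ^+ 2).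

Definition nnz v : nat := #|[set j | v 0 j != 0]%SET|.

End vectors.

Definition huber {R : realType} (t : R) : R :=
  if 1 < `|t| then `|t| - 2^-1 else t ^+ 2 / 2.

Definition huber_lasso {R : realType} {n d : nat} (lambda_o lambda_s : R)
    (x : 'I_n -> 'rV[R]_d) (y : 'I_n -> R) (beta : 'rV[R]_d) : R :=
  \sum_i lambda_o ^+ 2 *
      huber ((y i - inner (x i) beta) / (lambda_o * Num.sqrt n%:R))
  + lambda_s * norm1 beta.

Definition argmin {V : Type} {R : realType} (f : V -> R) : set V :=
  [set b | forall b', f b <= f b'].

Section random_elements.
Context {disp : measure_display} {T : measurableType disp} {R : realType}.
Variable P : probability T R.

(* The infimum is taken in \bar R, so that it is +oo when no eta qualifies. *)
Definition psi_norm (alpha : R) (f : T -> R) : \bar R :=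
  ereal_inf [set eta%:E | eta in
    [set eta : R | 0 < eta /\
      ('E_P[fun w => (expR (`|f w / eta| `^ alpha))%R] <= 2%:E)%E]].

Definition mean_vec {d : nat} (X : T -> d.-tuple R) : 'rV[R]_d :=
  \row_j fine ('E_P[fun w => tnth (X w) j])%E.

Definition subexponential {d : nat} (L : R) (X : T -> d.-tuple R) : Prop :=
  forall v : 'rV[R]_d,
    let f := fun w => inner (vec (X w) - mean_vec X) v in
    (psi_norm 1 f <= L%:E * sqrte 'E_P[fun w => (f w ^+ 2)%R])%E.

Definition centered {d : nat} (X : T -> d.-tuple R) : Prop :=
  forall j, ('E_P[fun w => tnth (X w) j] = 0)%E.

Definition isotropic {d : nat} (X : T -> d.-tuple R) : Prop :=
  forall j k, ('E_P[fun w => (tnth (X w) j * tnth (X w) k)%R] = (j == k)%:R%:E)%E.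

Section families.
Context {disp1 disp2 : measure_display}
  {T1 : measurableType disp1} {T2 : measurableType disp2}.

Definition mutually_independent {I : finType} (X : I -> T -> T1) : Prop :=
  forall (J : {set I}) (A : I -> set T1),
    (forall i, i \in J -> measurable (A i)) ->
    P (\bigcap_(i in [set` J]) (X i @^-1` A i)) =
      (\prod_(i in J) P (X i @^-1` A i))%E.

Definition identically_distributed {I : Type} (X : I -> T -> T1) : Prop :=
  forall i j (A : set T1), measurable A ->
    P (X i @^-1` A) = P (X j @^-1` A).

Definition iid {I : finType} (X : I -> T -> T1) : Prop :=
  mutually_independent X /\ identically_distributed X.

Definition independent_families {m n : nat}
    (X : 'I_m -> T -> T1) (Y : 'I_n -> T -> T2) : Prop :=
  forall A B : set T, g_sigma_preimage X A -> g_sigma_preimage Y B ->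
    P (A `&` B) = (P A * P B)%E.

End families.
End random_elements.

(* Main.v *)
(** Write rho = r_ds + r_delta, tau = lambda_o sqrt n and u = beta - beta_star.
The l1 penalty, together with a bound (1/n) sum_i H'(xi_i/tau) <x_i, u> <=
A (|u|_2 + |u|_1 / sqrt s) with A of order L rho, forces |u|_1 <= 3 sqrt s |u|_2
for the minimizer; by convexity it then suffices to exclude |u|_2 = r_2 in this
cone, where the strong convexity of H near 0 reduces the claim to a lower bound of
order |u|_2^2 for the truncated quadratic form
(1/n) sum_i min(|<x_i, u>|, tau/2)^2 1(|xi_i| <= tau/2).

No symmetrization or chaining is used: every uniform bound is a Chernoff bound plus
a union bound over the integer vectors k with |k|^2 <= Q s, of which there are at
most exp((Q + 3) s log(d/s)).  Linear forms pass from the grid to all vectors by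
duality, which gives the gradient bound.  For the quadratic form, u is rounded
towards 0 to a grid vector, where the lower tail is controlled by fourth moments;
the truncated quadratic form of the remainder is bounded, again by duality, through
the Huber function of the grid points. *)

Require Import Defs.
From HB Require Import structures.
From mathcomp Require Import all_boot all_order all_algebra.
From mathcomp Require Import all_classical all_reals all_analysis.
From mathcomp Require Import measurable_realfun zify ring lra.

Set Implicit Arguments.
Unset Strict Implicit.
Unset Printing Implicit Defensive.

Import Order.TTheory GRing.Theory Num.Theory.
Import numFieldNormedType.Exports.

Local Open Scope classical_set_scope.
Local Open Scope ring_scope.

(** The truncated quadratic form is not convex in u, so duality cannot reach it directly, and a net
    of a full-dimensional ball would cost d instead of s log(d/s). Rounding towards 0 with mesh h
    leaves a remainder w whose coordinates are at most min(h, |u_j|), hence |w|_2^2 <= h |u|_1, and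
    in the cone |u|_1 <= 3 sqrt s r. With h = r / (q sqrt s) the remainder is a small multiple of r,
    while the grid point is h k with |k|^2 <= q^2 s. A large q only raises the constant in the
    entropy, which the size 10^9 of C_0 absorbs. Isotropy forces L^2 >= 8/25. This turns the lower
    bound on lambda_o into a small probability of |xi_i| > tau/2, and the condition on 320 L^4 into
    a small truncation bias at radius r_2. *)

Section simple_approximation.
Local Open Scope ereal_scope.
Context {disp : measure_display} {T : measurableType disp} {R : realType}.
Variable P : probability T R.

Import HBNNSimple.

Lemma expectationE (X : T -> R) : 'E_P[X] = \int[P]_w (X w)%:E.
Proof. by rewrite unlock. Qed.

Lemma expectation_mul_nnsfun (W Y : T -> R) (c : \bar R) (h : {nnsfun R >-> R}) :
  measurable_fun setT W -> (forall w, 0 <= W w)%R -> measurable_fun setT Y ->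
  (forall B, measurable B ->
     'E_P[fun w => (W w * \1_B (Y w))%R] = c * P (Y @^-1` B))%E ->
  ('E_P[fun w => (W w * h (Y w))%R] = c * 'E_P[fun w => h (Y w)])%E.
Proof.
move=> mW W0 mY H.
have mI r : measurable_fun setT (fun w => \1_(h @^-1` [set r]) (Y w) : R).
  exact: measurableT_comp.
have hE w : h (Y w) = (\sum_(r \in range h) (r * \1_(h @^-1` [set r]) (Y w)))%R.
  by rewrite fimfunE.
have r0 r : r \in range h -> (0 <= r)%R.
  by rewrite inE => -[t _ <-].
have ri r w : (0 <= r * \1_(h @^-1` [set r]) (Y w))%R by exact: nnfun_muleindic_ge0.
transitivity (\sum_(r \in range h) (r%:E * (c * P (Y @^-1` (h @^-1` [set r])))))%E.
  rewrite !expectationE.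
  rewrite (eq_integral (fun w => (\sum_(r \in range h)
      ((W w)%:E * (r * \1_(h @^-1` [set r]) (Y w))%:E))%E)); last first.
    by move=> w _; rewrite EFinM hE -fsumEFin// ge0_mule_fsumr// => r; rewrite lee_fin.
  rewrite ge0_integral_fsum//; last 2 first.
    - move=> r; apply/measurable_EFinP; apply: measurable_funM => //.
      exact: measurable_funM.
    - by move=> r w _; rewrite -EFinM lee_fin mulr_ge0.
  apply: eq_fsbigr => r /r0 rr.
  rewrite -H// !expectationE -ge0_integralZl//; last 2 first.
    - by apply/measurable_EFinP; apply: measurable_funM.
    - by move=> w _; rewrite lee_fin mulr_ge0.
  by apply: eq_integral => w _; rewrite -!EFinM mulrCA.
rewrite !expectationE.
rewrite [in RHS](eq_integral (fun w => (\sum_(r \in range h)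
      (r * \1_(h @^-1` [set r]) (Y w))%:E)%E)); last first.
  by move=> w _; rewrite hE -fsumEFin.
rewrite ge0_integral_fsum//; last 2 first.
  - by move=> r; apply/measurable_EFinP; apply: measurable_funM.
  - by move=> r w _; rewrite lee_fin.
rewrite ge0_mule_fsumr; last first.
  by move=> r; apply: integral_ge0 => w _; rewrite lee_fin.
apply: eq_fsbigr => r /r0 rr.
under [in RHS]eq_integral => w _ do rewrite EFinM.
rewrite ge0_integralZl//; last first.
  by apply/measurable_EFinP.
have <- : 'E_P[\1_(Y @^-1` (h @^-1` [set r]))] = P (Y @^-1` (h @^-1` [set r])).
  rewrite expectation_indic// -[X in measurable X]setTI; exact: mY.
by rewrite muleCA !expectationE.
Qed.

(** Approximation by simple functions, with [c] in the role of the expectation of [W]: independence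
    enters only through indicators of [Y], which an induction on the number of factors can
    supply. *)
Lemma expectation_mul_ge0 (W Y : T -> R) (c : \bar R) :
  measurable_fun setT W -> (forall w, 0 <= W w)%R ->
  measurable_fun setT Y -> (forall w, 0 <= Y w)%R -> c \is a fin_num ->
  (forall B, measurable B ->
     'E_P[fun w => (W w * \1_B (Y w))%R] = c * P (Y @^-1` B))%E ->
  ('E_P[fun w => (W w * Y w)%R] = c * 'E_P[Y])%E.
Proof.
move=> mW W0 mY Y0 cfin H.
pose g (t : R) := (Num.max t 0)%:E%R.
have mg : measurable_fun setT g by apply/measurable_EFinP; exact: measurable_maxr.
have g0 t : setT t -> (0 <= g t)%E by move=> _; rewrite lee_fin le_max lexx orbT.
pose h := nnsfun_approx measurableT mg.
have gY w : (Y w)%:E = g (Y w) by rewrite /g; congr EFin; apply/esym/max_idPl.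
have cvh w : EFin \o h ^~ (Y w) @ \oo --> (Y w)%:E.
  by rewrite gY; exact: cvg_nnsfun_approx.
have mhY n : measurable_fun setT (fun w => h n (Y w)) by exact: measurableT_comp.
have ndh x : {homo (fun n => h n x) : a b / (a <= b)%N >-> (a <= b)%R}.
  by move=> a b ab; exact/lefP/nd_nnsfun_approx.
have L1 : ('E_P[fun w => h n (Y w)] @[n --> \oo] --> 'E_P[Y])%E.
  under eq_fun do rewrite expectationE.
  rewrite expectationE (_ : (\int[P]_w (Y w)%:E = \int[P]_w (limn (fun n => (h n (Y w))%:E)))%E); last first.
    by apply: eq_integral => w _; apply/esym/cvg_lim => //; exact: cvh.
  apply: cvg_monotone_convergence => //.
  - by move=> n; apply/measurable_EFinP.
  - by move=> n w _; rewrite lee_fin.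
  - by move=> w _ a b ab; rewrite lee_fin; exact: ndh.
have L2 : ('E_P[fun w => (W w * h n (Y w))%R] @[n --> \oo] --> 'E_P[fun w => (W w * Y w)%R])%E.
  under eq_fun do rewrite expectationE.
  rewrite expectationE.
  have cvW w : (W w * h n (Y w))%:E @[n --> \oo] --> (W w * Y w)%:E.
    under eq_fun do rewrite EFinM.
    by rewrite EFinM; apply: cvgeZl => //; exact: cvh.
  rewrite (_ : (\int[P]_w (W w * Y w)%:E = \int[P]_w (limn (fun n => (W w * h n (Y w))%:E)))%E); last first.
    by apply: eq_integral => w _; apply/esym/cvg_lim => //; exact: cvW.
  apply: cvg_monotone_convergence => //.
  - by move=> n; apply/measurable_EFinP; exact: measurable_funM.
  - by move=> n w _; rewrite lee_fin mulr_ge0.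
  - by move=> w _ a b ab; rewrite lee_fin ler_wpM2l//; exact: ndh.
apply: (cvg_unique _ L2) => //.
rewrite (_ : (fun n => _) = (fun n => c * 'E_P[fun w => h n (Y w)])).
  exact: cvgeZl.
by apply/funext => n; exact: expectation_mul_nnsfun.
Qed.

End simple_approximation.

(** * Expectations of products of independent variables *)

Section product_expectation.
Local Open Scope ereal_scope.
Context {disp : measure_display} {T : measurableType disp} {R : realType}.
Variable P : probability T R.

(* Starting from indicators, the factors are replaced by the f k one at a time. *)
Lemma expectation_prod_independent (K : finType) (f : K -> T -> R) :
  (forall k, measurable_fun setT (f k)) -> (forall k w, 0 <= f k w)%R ->
  (forall k, 'E_P[f k] \is a fin_num) ->
  (forall B : K -> set R, (forall k, measurable (B k)) ->
     P (\bigcap_k (f k @^-1` B k)) = \prod_k P (f k @^-1` B k)) ->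
  'E_P[fun w => (\prod_k f k w)%R] = \prod_k 'E_P[f k].
Proof.
move=> mf f0 ff fP.
have mpre k B : measurable B -> measurable (f k @^-1` B).
  by move=> mB; rewrite -[X in measurable X]setTI; exact: mf.
(* Factors in [S] are already the [f k], the others still indicators. The induction on the size of
   [S] quantifies over [B], so that a factor [k0] taken out of [S] can receive an arbitrary test set
   [B0]. *)
pose g (S : {set K}) (B : K -> set R) k w : R :=
  if k \in S then f k w else \1_(B k) (f k w).
pose p (S : {set K}) (B : K -> set R) k :=
  if k \in S then 'E_P[f k] else P (f k @^-1` B k).
have mg S B k : measurable (B k) -> measurable_fun setT (g S B k).
  by rewrite /g; case: (k \in S) => // mB; exact: measurableT_comp.
have g0 S B k w : (0 <= g S B k w)%R by rewrite /g; case: ifP.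
suff H n (S : {set K}) B : #|S| = n -> (forall k, measurable (B k)) ->
    'E_P[fun w => (\prod_k g S B k w)%R] = \prod_k p S B k.
  have := H _ [set: K]%SET (fun=> setT) erefl (fun=> measurableT).
  rewrite /g /p.
  by under eq_fun do under eq_bigr do rewrite inE; under eq_bigr do rewrite inE.
elim: n S B => [|n IH] S B Sn mB.
  move: Sn => /eqP; rewrite cards_eq0 => /eqP ->.
  rewrite (_ : (fun w => _) = \1_(\bigcap_k (f k @^-1` B k))).
    rewrite expectation_indic; last first.
      by apply: fin_bigcap_measurable => // k _; exact: mpre.
    by rewrite fP//; apply: eq_bigr => k _; rewrite /p inE.
  apply/funext => w; under eq_bigr do rewrite /g inE indicE.
  rewrite indicE; have [wB|wB] := boolP (w \in _).
    by rewrite big1// => k _; move: wB; rewrite inE => /(_ k I) wB; rewrite mem_set.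
  have [k wk] : exists k, f k w \notin B k.
    apply/not_existsP => h; move/negP: wB; apply; rewrite inE => k _.
    by have /negP := h k; rewrite negbK inE.
  by rewrite (bigD1 k)//= (negbTE wk) mul0r.
have [k0 k0S] : exists k, k \in S by apply/set0Pn; rewrite -card_gt0 Sn.
rewrite (bigD1 k0)//= muleC {2}/p k0S.
pose W w := (\prod_(k | k != k0) g (S :\ k0)%SET B k w)%R.
transitivity 'E_P[fun w => (W w * f k0 w)%R].
  congr ('E_P[_]); apply/funext => w; rewrite (bigD1 k0)//= mulrC {2}/g k0S; congr (_ * _)%R.
  by apply: eq_bigr => k kk0; rewrite /g !inE kk0.
apply: expectation_mul_ge0 => //.
- rewrite /W; under eq_fun do rewrite -big_filter.
  by apply: measurable_prod => k _; exact: mg.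
- by move=> w; apply: prodr_ge0.
- apply: prode_fin_num => k _; rewrite /p; case: ifP => // _.
  by rewrite fin_num_measure//; exact: mpre.
move=> B0 mB0.
pose B' k := if k == k0 then B0 else B k.
have mB' k : measurable (B' k) by rewrite /B'; case: ifP.
have := IH (S :\ k0)%SET B' _ mB'.
rewrite (cardsD1 k0) k0S in Sn; case: Sn => Sn /(_ Sn).
have p0 : p (S :\ k0)%SET B' k0 = P (f k0 @^-1` B0) by rewrite /p !inE eqxx /= /B' eqxx.
rewrite [in X in _ -> X](_ : \prod_(k | k != k0) p S B k = \prod_(k | k != k0) p (S :\ k0)%SET B' k); last first.
  by apply: eq_bigr => k kk0; rewrite /p /B' !inE kk0 (negbTE kk0).
rewrite [X in _ = X](bigD1 k0)//= p0 muleC => <-.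
congr ('E_P[_]); apply/funext => w.
rewrite (bigD1 k0)//= {1}/g !inE eqxx /= /B' eqxx mulrC; congr (_ * _)%R.
by apply: eq_bigr => k kk0; rewrite /g !inE kk0 /= (negbTE kk0).
Qed.

End product_expectation.

Section independent_families.
Local Open Scope ereal_scope.
Context {disp d1 d2 : measure_display} {T : measurableType disp}
  {T1 : measurableType d1} {T2 : measurableType d2} {R : realType}.
Variable P : probability T R.

Lemma g_sigma_preimage_bigcap (n : nat) d' (T' : measurableType d')
    (X : 'I_n -> T -> T') (A : 'I_n -> set T') :
  (forall i, measurable (A i)) ->
  g_sigma_preimage X (\bigcap_i (X i @^-1` A i)).
Proof.
move=> mA.
pose G : set (set T) := \big[setU/set0]_(i < n) preimage_set_system setT (X i) measurable.
change (@measurable _ (g_sigma_algebraType G) (\bigcap_i (X i @^-1` A i))).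
apply: fin_bigcap_measurable; first exact: finite_finset.
move=> i _; apply: sub_sigma_algebra.
rewrite /G (bigD1 i)//=; left; exists (A i) => //.
by rewrite setTI.
Qed.

Variable n : nat.
Variables (x : 'I_n -> {RV P >-> T1}) (xi : 'I_n -> {RV P >-> T2}).
Hypotheses (ix : mutually_independent P x) (ixi : mutually_independent P xi)
  (ixxi : independent_families P x xi).

(** Independence within each family and between the two makes the family indexed by ['I_n + 'I_n]
    independent, so the product rule applies to all 2n factors at once. *)
Lemma expectation_prod_families (w : 'I_n -> T1 -> R) (u : 'I_n -> T2 -> R) :
  (forall i, measurable_fun setT (w i)) -> (forall i t, 0 <= w i t)%R ->
  (forall i, measurable_fun setT (u i)) -> (forall i t, 0 <= u i t)%R ->
  (forall i, 'E_P[w i \o x i] \is a fin_num) ->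
  (forall i, 'E_P[u i \o xi i] \is a fin_num) ->
  'E_P[fun t => (\prod_i (u i (xi i t) * w i (x i t)))%R] =
  \prod_i ('E_P[u i \o xi i] * 'E_P[w i \o x i]).
Proof.
move=> mw w0 mu u0 fw fu.
pose f (k : 'I_n + 'I_n) : T -> R := match k with
  inl i => w i \o x i | inr i => u i \o xi i end.
transitivity 'E_P[fun t => (\prod_k f k t)%R].
  congr ('E_P[_]); apply/funext => t.
  by rewrite big_sumType/= big_split/= mulrC.
rewrite expectation_prod_independent.
- by rewrite big_sumType/= big_split/= muleC.
- by case=> i /=; apply: measurableT_comp.
- by case=> i t /=.
- by case=> i /=.
move=> B mB.
pose A1 i := w i @^-1` B (inl i); pose A2 i := u i @^-1` B (inr i).
have mA1 i : measurable (A1 i) by rewrite -[X in measurable X]setTI; exact: mw.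
have mA2 i : measurable (A2 i) by rewrite -[X in measurable X]setTI; exact: mu.
rewrite (_ : \bigcap_k _ = (\bigcap_i (x i @^-1` A1 i)) `&` (\bigcap_i (xi i @^-1` A2 i))); last first.
  apply/seteqP; split => [t h|t [h1 h2] [i _|i _]].
  - split=> i _; first exact: (h (inl i) I).
    exact: (h (inr i) I).
  - exact: (h1 i I).
  - exact: (h2 i I).
rewrite ixxi; [|exact: g_sigma_preimage_bigcap..].
rewrite big_sumType/=; congr (_ * _).
- have := @ix [set: 'I_n]%SET A1 (fun i _ => mA1 i).
  rewrite (_ : [set` [set: 'I_n]%SET] = setT); last by apply/seteqP; split => // i _ /=; rewrite inE.
  by move=> ->; apply: eq_bigl => i; rewrite inE.
- have := @ixi [set: 'I_n]%SET A2 (fun i _ => mA2 i).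
  rewrite (_ : [set` [set: 'I_n]%SET] = setT); last by apply/seteqP; split => // i _ /=; rewrite inE.
  by move=> ->; apply: eq_bigl => i; rewrite inE.
Qed.

(** Distributivity expands the product into monomials indexed by functions from ['I_n] to [J]; each
    one factorizes, and the products of means are collected again. This handles summands that mix
    [xi i] with [x i]. *)
Lemma expectation_prod_families_sum (J : finType) (w : J -> T1 -> R) (u : J -> T2 -> R)
    (a b : 'I_n -> J -> R) :
  (forall j, measurable_fun setT (w j)) -> (forall j t, 0 <= w j t)%R ->
  (forall j, measurable_fun setT (u j)) -> (forall j t, 0 <= u j t)%R ->
  (forall i j, 'E_P[u j \o xi i] = (a i j)%:E) ->
  (forall i j, 'E_P[w j \o x i] = (b i j)%:E) ->
  'E_P[fun t => (\prod_i \sum_j (u j (xi i t) * w j (x i t)))%R] =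
  (\prod_i \sum_j (a i j * b i j))%R%:E.
Proof.
move=> mw w0 mu u0 ea eb.
have mt i j : measurable_fun setT (fun t => u j (xi i t) * w j (x i t))%R.
  by apply: measurable_funM; exact: measurableT_comp.
rewrite expectationE.
under eq_integral do rewrite bigA_distr_bigA -sumEFin.
rewrite ge0_integral_sum//; last 2 first.
- by move=> f; apply/measurable_EFinP; apply: measurable_prod => i _.
- by move=> f t _; rewrite lee_fin; apply: prodr_ge0 => i _; exact: mulr_ge0.
rewrite bigA_distr_bigA -sumEFin; apply: eq_bigr => f _.
rewrite -expectationE (@expectation_prod_families (fun i => w (f i)) (fun i => u (f i)))//.
- by rewrite -prodEFin; apply: eq_bigr => i _; rewrite ea eb.
- by move=> i; rewrite eb.
- by move=> i; rewrite ea.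
Qed.

End independent_families.

(** * Linear forms of a centered isotropic sub-exponential vector *)

Section marginals.
Local Open Scope ereal_scope.
Context {disp : measure_display} {T : measurableType disp} {R : realType}.
Variable P : probability T R.
Variable d : nat.

Lemma innerE (t : d.-tuple R) (v : 'rV[R]_d) :
  inner (vec t) v = (\sum_j tnth t j * v 0 j)%R.
Proof. by apply: eq_bigr => j _; rewrite mxE. Qed.

Lemma measurable_inner (v : 'rV[R]_d) :
  measurable_fun setT (fun t : d.-tuple R => inner (vec t) v).
Proof.
under eq_fun do rewrite innerE.
apply: measurable_sum => j; apply: measurable_funM => //.
exact: measurable_tnth.
Qed.

Lemma norm2_ge0 (v : 'rV[R]_d) : (0 <= norm2 v)%R.
Proof. exact: sqrtr_ge0. Qed.

Lemma sqr_norm2 (v : 'rV[R]_d) : (norm2 v ^+ 2 = \sum_j v 0 j ^+ 2)%R.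
Proof. by rewrite sqr_sqrtr// sumr_ge0// => j _; exact: sqr_ge0. Qed.

Variable X : {RV P >-> d.-tuple R}.
Hypotheses (cX : centered P X) (iX : isotropic P X).

Let mX j : measurable_fun setT (fun w => tnth (X w) j).
Proof. by apply: (measurableT_comp (measurable_tnth j)). Qed.

Lemma integrable_tnthM j k :
  P.-integrable setT (fun w => (tnth (X w) j * tnth (X w) k)%:E).
Proof.
have sq i : P.-integrable setT (fun w => (tnth (X w) i ^+ 2)%:E).
  apply/integrableP; split; first by apply/measurable_EFinP; exact: measurable_funX.
  under eq_integral do rewrite abse_EFin ger0_norm ?sqr_ge0//.
  under eq_integral do rewrite expr2.
  by rewrite -expectationE iX ltry.
apply: (@le_integrable _ _ _ P setT measurableT _
   ((fun w => (tnth (X w) j ^+ 2)%:E) \+ (fun w => (tnth (X w) k ^+ 2)%:E))).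
- by apply/measurable_EFinP; exact: measurable_funM.
- move=> w _ /=; rewrite lee_fin [leRHS]ger0_norm ?addr_ge0 ?sqr_ge0//.
  rewrite ler_norml; apply/andP; split; nra.
- exact: integrableD.
Qed.

Lemma integrable_tnth j : P.-integrable setT (fun w => (tnth (X w) j)%:E).
Proof.
apply: (@le_integrable _ _ _ P setT measurableT _
   (cst 1 \+ (fun w => (tnth (X w) j * tnth (X w) j)%:E))).
- by apply/measurable_EFinP.
- move=> w _ /=; rewrite lee_fin [leRHS]ger0_norm; last by nra.
  rewrite ler_norml; apply/andP; split; nra.
- apply: integrableD => //; last exact: integrable_tnthM.
  exact: finite_measure_integrable_cst.
Qed.

Lemma integrable_inner v : P.-integrable setT (fun w => (inner (vec (X w)) v)%:E).
Proof.
under eq_fun do rewrite innerE -sumEFin.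
apply: integrable_sum => // j _.
under eq_fun do rewrite mulrC EFinM.
by apply: integrableZl => //; exact: integrable_tnth.
Qed.

Lemma expectation_inner v : 'E_P[fun w => inner (vec (X w)) v] = 0.
Proof.
rewrite expectationE.
under eq_integral do rewrite innerE -sumEFin.
rewrite integral_sum//; last first.
  move=> j; under eq_fun do rewrite mulrC EFinM.
  by apply: integrableZl => //; exact: integrable_tnth.
rewrite big1// => j _.
under eq_integral do rewrite mulrC EFinM.
rewrite integralZl//; last exact: integrable_tnth.
by have := cX j; rewrite expectationE => ->; rewrite mule0.
Qed.

Lemma expectation_inner_sqr v :
  'E_P[fun w => (inner (vec (X w)) v ^+ 2)%R] = (norm2 v ^+ 2)%:E.
Proof.
rewrite expectationE sqr_norm2.
have e w : (inner (vec (X w)) v ^+ 2 =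
    \sum_j \sum_k (v 0 j * v 0 k) * (tnth (X w) j * tnth (X w) k))%R.
  rewrite innerE expr2 mulr_suml; apply: eq_bigr => j _.
  by rewrite mulr_sumr; apply: eq_bigr => k _; ring.
under eq_integral do rewrite e -sumEFin.
have ii j k : P.-integrable setT
   (fun w => (v 0 j * v 0 k * (tnth (X w) j * tnth (X w) k))%:E).
  under eq_fun do rewrite EFinM.
  by apply: integrableZl => //; exact: integrable_tnthM.
rewrite integral_sum//; last first.
  move=> j; under eq_fun do rewrite -sumEFin.
  by apply: integrable_sum => // k _; exact: ii.
rewrite -sumEFin; apply: eq_bigr => j _.
under eq_integral do rewrite -sumEFin.
rewrite integral_sum//.
have ie k : \int[P]_w (v 0 j * v 0 k * (tnth (X w) j * tnth (X w) k))%:E =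
   (v 0 j * v 0 k * (j == k)%:R)%:E.
  under eq_integral do rewrite EFinM.
  rewrite integralZl//; last exact: integrable_tnthM.
  by have := iX j k; rewrite expectationE => ->; rewrite -EFinM.
under eq_bigr do rewrite ie.
rewrite (bigD1 j)//= big1 ?adde0; first by rewrite eqxx mulr1 expr2.
by move=> k kj; rewrite eq_sym (negbTE kj) mulr0.
Qed.

Lemma mean_vec0 : (mean_vec P X = 0)%R.
Proof. by apply/rowP => j; rewrite !mxE; have -> := cX j. Qed.

(** The infimum in [psi_norm] need not be attained and [norm2 v] may vanish; with [K] above [L] and
    a positive bound [nu] the inequality is strict, so an admissible [eta] below [K * nu] exists. *)
Lemma subexponential_expR (L K nu : R) (v : 'rV[R]_d) :
  subexponential P L X -> (0 < nu)%R -> (norm2 v <= nu)%R -> (0 < L)%R -> (L < K)%R ->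
  'E_P[fun w => expR (`|inner (vec (X w)) v| / (K * nu))%R] <= 2%:E.
Proof.
move=> sX nu0 vnu L0 LK.
have := sX v; rewrite /= mean_vec0.
under [X in psi_norm _ _ X]eq_fun do rewrite subr0.
under [X in 'E_P[X]]eq_fun do rewrite subr0.
rewrite expectation_inner_sqr EFin_expe sqrte_sqr gee0_abs ?lee_fin ?norm2_ge0//.
rewrite -EFinM => h.
have {h} : psi_norm P 1 (fun w => inner (vec (X w)) v) < (K * nu)%:E.
  apply: le_lt_trans h _; rewrite lte_fin.
  by apply: (@le_lt_trans _ _ (L * nu)%R); rewrite ?ler_pM2l// ltr_pM2r.
move=> /ereal_inf_lt[_ [eta [eta0 h] <-]]; rewrite lte_fin => etaK.
have mf : measurable_fun setT (fun w => inner (vec (X w)) v).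
  exact: (measurableT_comp (measurable_inner v)).
apply: le_trans h; rewrite !expectationE; apply: ge0_le_integral => //.
- apply/measurable_EFinP; apply: measurableT_comp => //; apply: measurable_funM => //.
  exact: measurableT_comp.
- apply/measurable_EFinP; apply: measurableT_comp => //.
  apply: (measurableT_comp (measurable_powR 1%R)); apply: measurableT_comp => //.
  exact: measurable_funM.
- move=> w _; rewrite lee_fin ler_expR powRr1// normrM normfV (gtr0_norm eta0).
  by rewrite ler_wpM2l// lef_pV2 ?posrE ?ltW// (lt_trans eta0).
Qed.

End marginals.

(** * Scalar inequalities for the exponential, clipping and the Huber function *)

Section elementary.
Context {R : realType}.
Implicit Types y t a T lam : R.

Lemma expR_le_1Dx_sqr y : expR y <= 1 + y + y ^+ 2 * expR `|y|.
Proof.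
have e1 : 1 + y <= expR y by exact: expR_ge1Dx.
have e2 : expR y - 1 <= y * expR y.
  have : 1 + - y <= expR (- y) by exact: expR_ge1Dx.
  rewrite expRN => h; have e0 : 0 < expR y := expR_gt0 y.
  have : expR y * (1 - y) <= expR y * (expR y)^-1 by rewrite ler_pM2l.
  by rewrite mulfV ?gt_eqF//; lra.
have [y0|y0] := leP 0 y; first by rewrite ger0_norm//; nra.
have : 1 <= expR `|y| by rewrite -[leLHS]expR0 ler_expR.
have : expR y <= 1 by rewrite expR_le1 ltW.
by nra.
Qed.

(** Only half of the exponent is spent on the power; the other half absorbs the exponential factor
    of a Taylor remainder. *)
Lemma sqr_le_expR t : 0 <= t -> t ^+ 2 <= 8 * expR (t / 2).
Proof.
move=> t0; have := @expR_ge1Dxn R (t / 2) 1 (divr_ge0 t0 (ler0n _ _)).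
have -> : (t / 2) ^+ 2 / 2`!%:R = t ^+ 2 / 8 by rewrite (_ : 2`! = 2)%N//; field.
by lra.
Qed.

Lemma expr4_le_expR t : 0 <= t -> t ^+ 4 <= 384 * expR (t / 2).
Proof.
move=> t0; have := @expR_ge1Dxn R (t / 2) 3 (divr_ge0 t0 (ler0n _ _)).
have -> : (t / 2) ^+ 4 / 4`!%:R = t ^+ 4 / 384 by rewrite (_ : 4`! = 24)%N//; field.
by lra.
Qed.

Definition clip T a : R := Num.max (- T) (Num.min a T).

Lemma clip_norm T a : 0 <= T -> `|clip T a| <= T.
Proof.
move=> T0; rewrite /clip ler_norml; apply/andP; split; first by rewrite le_max lexx.
by rewrite ge_max; apply/andP; split; [lra|rewrite ge_min lexx orbT].
Qed.

Lemma clip_id T a : `|a| <= T -> clip T a = a.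
Proof.
rewrite ler_norml => /andP[h1 h2]; rewrite /clip.
by rewrite (min_idPl h2); apply/max_idPr.
Qed.

Lemma clip_gt T a : 0 <= T -> T < `|a| -> (T < a /\ clip T a = T) \/ (a < - T /\ clip T a = - T).
Proof.
move=> T0; rewrite /clip lter_normr => /orP[h|h].
  by left; split => //; rewrite (min_idPr (ltW h)); apply/max_idPr; lra.
right; split; first by lra.
by rewrite min_l; [apply/max_idPl; lra|lra].
Qed.

Lemma sqr_clip_le T a : 0 <= T -> clip T a ^+ 2 <= clip T a * a.
Proof.
move=> T0; have [h|h] := leP `|a| T; first by rewrite clip_id// expr2.
by case: (clip_gt T0 h) => -[h1 ->]; nra.
Qed.

Lemma sqr_clip_le_sqr T a : 0 <= T -> clip T a ^+ 2 <= a ^+ 2.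
Proof.
move=> T0; have [h|h] := leP `|a| T; first by rewrite clip_id.
by case: (clip_gt T0 h) => -[h1 ->]; nra.
Qed.

(** Beyond the threshold, 4 T^2 (a^2 - T^2) <= a^4 amounts to (a^2 - 2 T^2)^2 >= 0. Truncation thus
    costs a fourth moment only. *)
Lemma sqr_clip_ge T a : 0 < T -> a ^+ 2 <= clip T a ^+ 2 + a ^+ 4 / (4 * T ^+ 2).
Proof.
move=> T0; have a4 : 0 <= a ^+ 4 / (4 * T ^+ 2).
  by apply: divr_ge0; [exact: exprn_even_ge0|rewrite mulr_ge0 ?sqr_ge0].
have [h|h] := leP `|a| T; first by rewrite clip_id//; lra.
have -> : clip T a ^+ 2 = T ^+ 2.
  by case: (clip_gt (ltW T0) h) => -[h1 ->]; rewrite ?sqrrN.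
have -> : a ^+ 4 / (4 * T ^+ 2) = (a ^+ 2 - 2 * T ^+ 2) ^+ 2 / (4 * T ^+ 2) + a ^+ 2 - T ^+ 2.
  by field; exact: lt0r_neq0.
have : 0 <= (a ^+ 2 - 2 * T ^+ 2) ^+ 2 / (4 * T ^+ 2).
  by apply: divr_ge0; [exact: sqr_ge0|rewrite mulr_ge0 ?sqr_ge0].
lra.
Qed.

Lemma measurable_clip T : measurable_fun setT (clip T).
Proof. by apply: measurable_maxr => //; exact: measurable_minr. Qed.

(** The Huber function with threshold [T] in dual form: the maximum of theta a - theta^2 / 2 over
    |theta| <= T, attained at theta = [clip T a], which is also its derivative. [young_huber_at] is
    the Fenchel-Young inequality. *)
Definition huber_at T a : R := clip T a * a - clip T a ^+ 2 / 2.

Lemma huber_at_ge0 T a : 0 <= T -> 0 <= huber_at T a.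
Proof. by move=> /(sqr_clip_le a); have := sqr_ge0 (clip T a); rewrite /huber_at; lra. Qed.

Lemma huber_at_le_sqr T a : huber_at T a <= a ^+ 2 / 2.
Proof. by rewrite /huber_at; have := sqr_ge0 (a - clip T a); lra. Qed.

Lemma huber_at_le_lin T a : 0 <= T -> huber_at T a <= T * `|a|.
Proof.
move=> T0; rewrite /huber_at; have := ler_norm (clip T a * a); rewrite normrM.
have := ler_wpM2r (normr_ge0 a) (clip_norm a T0); have := sqr_ge0 (clip T a); lra.
Qed.

Lemma young_huber_at T a th : 0 <= T -> `|th| <= T ->
  th * a <= th ^+ 2 / 2 + huber_at T a.
Proof.
rewrite /huber_at => T0 hth; have [h|h] := leP `|a| T.
  by rewrite clip_id//; have := sqr_ge0 (th - a); lra.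
move: hth; rewrite ler_norml => /andP[h1 h2].
by case: (clip_gt T0 h) => -[h3 ->]; nra.
Qed.

Lemma measurable_huber_at T : measurable_fun setT (huber_at T).
Proof.
apply: measurable_funB; first by apply: measurable_funM => //; exact: measurable_clip.
apply: measurable_funM => //; apply: measurable_funX; exact: measurable_clip.
Qed.

End elementary.

(** * Exponential moments of one sub-exponential variable *)

Section exponential_moments.
Local Open Scope ereal_scope.
Context {disp : measure_display} {T : measurableType disp} {R : realType}.
Variable P : probability T R.
Implicit Types f g A : T -> R.

Lemma ge0_expectation_le f g : measurable_fun setT f -> measurable_fun setT g ->
  (forall w, 0 <= f w)%R -> (forall w, f w <= g w)%R -> 'E_P[f] <= 'E_P[g].
Proof.
move=> mf mg f0 fg; apply: expectation_le => //; last exact: aeW.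
by move=> w; exact: le_trans (fg w).
Qed.

Lemma ge0_expectationD f g : measurable_fun setT f -> measurable_fun setT g ->
  (forall w, 0 <= f w)%R -> (forall w, 0 <= g w)%R ->
  'E_P[fun w => (f w + g w)%R] = 'E_P[f] + 'E_P[g].
Proof.
move=> mf mg f0 g0; rewrite !expectationE.
under eq_integral do rewrite EFinD.
by rewrite ge0_integralD// => [|||]; try (by move=> w _; rewrite lee_fin);
  apply/measurable_EFinP.
Qed.

Lemma ge0_expectationZl c f : measurable_fun setT f -> (forall w, 0 <= f w)%R ->
  (0 <= c)%R -> 'E_P[fun w => (c * f w)%R] = c%:E * 'E_P[f].
Proof.
move=> mf f0 c0; rewrite !expectationE.
under eq_integral do rewrite EFinM.
by rewrite ge0_integralZl//; [exact/measurable_EFinP|move=> w _; rewrite lee_fin].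
Qed.

Lemma expectation_const (c : R) : 'E_P[fun=> c] = c%:E.
Proof. exact: expectation_cst. Qed.

Variables (A : T -> R) (kap : R).
Hypotheses (mA : measurable_fun setT A) (kap0 : (0 < kap)%R)
  (hA : 'E_P[fun w => expR (`|A w| / kap)%R] <= 2%:E).

Let mexp : measurable_fun setT (fun w => expR (`|A w| / kap)).
Proof.
apply: measurableT_comp => //; apply: measurable_funM => //.
exact: measurableT_comp.
Qed.

Let t0 w : (0 <= `|A w| / kap)%R.
Proof. by rewrite divr_ge0// ltW. Qed.

Let sqrA w : (A w ^+ 2 = kap ^+ 2 * (`|A w| / kap) ^+ 2)%R.
Proof. by rewrite -[in LHS](real_normK (num_real (A w))); field; exact: lt0r_neq0. Qed.

Let exp2 w : (expR (`|A w| / kap / 2) * expR (`|A w| / kap / 2) = expR (`|A w| / kap))%R.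
Proof. by rewrite -expRD; congr expR; field; exact: lt0r_neq0. Qed.

Let Escale c : (0 <= c)%R -> 'E_P[fun w => (c * expR (`|A w| / kap))%R] <= (2 * c)%:E.
Proof.
move=> c0; rewrite ge0_expectationZl//.
by rewrite mulrC EFinM lee_wpmul2l// lee_fin.
Qed.

(** The remainder lam^2 A^2 exp |lam A| is integrable because |lam| kap <= 1/2 leaves half of |A| /
    kap for the square; 16 is the constant 8 of [sqr_le_expR] times the bound 2 in [hA]. *)
Lemma expectation_expR_centered lam : P.-integrable setT (EFin \o A) ->
  'E_P[A] = 0 -> (`|lam| * kap <= 2^-1)%R ->
  'E_P[fun w => expR (lam * A w)] <= (1 + 16 * lam ^+ 2 * kap ^+ 2)%:E.
Proof.
move=> iA EA hl.
pose G w := (8 * lam ^+ 2 * kap ^+ 2 * expR (`|A w| / kap))%R.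
have c0 : (0 <= 8 * lam ^+ 2 * kap ^+ 2)%R by rewrite mulr_ge0 ?sqr_ge0 1?mulr_ge0 ?sqr_ge0//.
have mG : measurable_fun setT G by exact: measurable_funM.
have EG : 'E_P[G] <= (16 * lam ^+ 2 * kap ^+ 2)%:E.
  by apply: (le_trans (Escale c0)); rewrite lee_fin; lra.
have G0 w : (0 <= G w)%R by rewrite mulr_ge0// expR_ge0.
have iG : P.-integrable setT (EFin \o G).
  apply/integrableP; split; first exact/measurable_EFinP.
  under eq_integral do rewrite /= ger0_norm//.
  by rewrite -expectationE; apply: le_lt_trans EG _; rewrite ltry.
have i1 : P.-integrable setT (EFin \o (fun w => 1 + lam * A w)%R).
  rewrite (_ : EFin \o _ = cst 1 \+ (fun w => lam%:E * (A w)%:E)); last first.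
    by apply/funext => w /=; rewrite EFinD EFinM.
  apply: integrableD => //; first exact: finite_measure_integrable_cst.
  exact: integrableZl.
have bnd w : (expR (lam * A w) <= 1 + lam * A w + G w)%R.
  apply: (le_trans (expR_le_1Dx_sqr _)); rewrite lerD2l /G exprMn sqrA.
  have h2 : (expR `|lam * A w| <= expR (`|A w| / kap / 2))%R.
    rewrite ler_expR normrM.
    have -> : (`|lam| * `|A w| = (`|lam| * kap) * (`|A w| / kap))%R.
      by field; exact: lt0r_neq0.
    by rewrite [leRHS]mulrC ler_wpM2r.
  have h1 := sqr_le_expR (t0 w).
  have e0 := expR_ge0 (`|A w| / kap / 2).
  have l0 : (0 <= lam ^+ 2 * kap ^+ 2)%R by rewrite mulr_ge0 ?sqr_ge0//.
  rewrite -exp2; set s := expR (_ / 2) in h1 h2 e0 *.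
  apply: (@le_trans _ _ ((lam ^+ 2 * kap ^+ 2) * ((8 * s) * s))%R); last by lra.
  rewrite [leLHS](_ : _ = (lam ^+ 2 * kap ^+ 2) * ((`|A w| / kap) ^+ 2 * expR `|lam * A w|))%R; last by ring.
  by rewrite ler_wpM2l// ler_pM ?sqr_ge0 ?expR_ge0.
have bnd1 : (forall w, 0 <= 1 + lam * A w + G w)%R.
  by move=> w; apply: le_trans (bnd w); exact: expR_ge0.
apply: (@le_trans _ _ 'E_P[fun w => (1 + lam * A w + G w)%R]).
  apply: ge0_expectation_le => //.
  - apply: measurableT_comp => //; exact: measurable_funM.
  - apply: measurable_funD => //; apply: measurable_funD => //.
    exact: measurable_funM.
rewrite expectationE.
have -> : \int[P]_w (1 + lam * A w + G w)%:E = \int[P]_w ((EFin \o (fun w => 1 + lam * A w)%R) \+ (EFin \o G)) w.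
  by apply: eq_integral => w _; rewrite EFinD.
rewrite integralD//.
have -> : \int[P]_w (EFin \o (fun w => 1 + lam * A w)%R) w = 1.
  rewrite (_ : EFin \o _ = cst 1 \+ (fun w => lam%:E * (A w)%:E)); last first.
    by apply/funext => w /=; rewrite EFinD EFinM.
  rewrite integralD//; last 2 first.
  - exact: finite_measure_integrable_cst.
  - exact: integrableZl.
  rewrite integral_cst// mul1e integralZl// -expectationE EA mule0 adde0.
  exact: probability_setT.
by rewrite EFinD leeD2l// -expectationE.
Qed.

(** The Huber function is bounded by A^2 / 2 in the linear term and in the square of the remainder,
    but by T0 |A| in its exponential factor, so only lam T0 kap has to be small. The constant 192 is
    384 / 4 times 2. *)
Lemma expectation_expR_huber_at lam T0 m2 : (0 <= T0)%R -> (0 <= lam)%R ->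
  'E_P[fun w => (A w ^+ 2)%R] = m2%:E -> (lam * T0 * kap <= 2^-1)%R ->
  'E_P[fun w => expR (lam * huber_at T0 (A w))] <=
  (1 + lam * m2 / 2 + 192 * lam ^+ 2 * kap ^+ 4)%:E.
Proof.
move=> T00 lam0 Em2 hl.
pose G w := (96 * lam ^+ 2 * kap ^+ 4 * expR (`|A w| / kap))%R.
have c0 : (0 <= 96 * lam ^+ 2 * kap ^+ 4)%R.
  by rewrite mulr_ge0 ?exprn_even_ge0 1?mulr_ge0 ?sqr_ge0//.
have mG : measurable_fun setT G by exact: measurable_funM.
have G0 w : (0 <= G w)%R by rewrite mulr_ge0// expR_ge0.
have mZ : measurable_fun setT (fun w => huber_at T0 (A w)).
  by apply: measurableT_comp => //; exact: measurable_huber_at.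
have bnd w : (expR (lam * huber_at T0 (A w)) <= 1 + lam / 2 * A w ^+ 2 + G w)%R.
  apply: (le_trans (expR_le_1Dx_sqr _)).
  have z0 := huber_at_ge0 (A w) T00; have z1 := huber_at_le_sqr T0 (A w).
  have z2 := huber_at_le_lin (A w) T00.
  have s1 : (lam * huber_at T0 (A w) <= lam / 2 * A w ^+ 2)%R.
    by rewrite -mulrA ler_wpM2l//; lra.
  rewrite ger0_norm ?mulr_ge0//.
  have h2 : (expR (lam * huber_at T0 (A w)) <= expR (`|A w| / kap / 2))%R.
    rewrite ler_expR; apply: (@le_trans _ _ (lam * (T0 * `|A w|))%R).
      exact: ler_wpM2l.
    have -> : (lam * (T0 * `|A w|) = (lam * T0 * kap) * (`|A w| / kap))%R.
      by field; exact: lt0r_neq0.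
    by rewrite [leRHS]mulrC ler_wpM2r.
  have h1 := expr4_le_expR (t0 w).
  have e0 := expR_ge0 (`|A w| / kap / 2).
  have l0 : (0 <= lam ^+ 2 * kap ^+ 4)%R by rewrite mulr_ge0 ?sqr_ge0 ?exprn_even_ge0//.
  have h3 : ((lam * huber_at T0 (A w)) ^+ 2 <= lam ^+ 2 * kap ^+ 4 * ((`|A w| / kap) ^+ 4 / 4))%R.
    have -> : (lam ^+ 2 * kap ^+ 4 * ((`|A w| / kap) ^+ 4 / 4) = (lam * (A w ^+ 2 / 2)) ^+ 2)%R.
      by rewrite sqrA; field; exact: lt0r_neq0.
    have u0 : (0 <= lam * huber_at T0 (A w))%R by exact: mulr_ge0.
    have v0 : (lam * huber_at T0 (A w) <= lam * (A w ^+ 2 / 2))%R by exact: ler_wpM2l.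
    by rewrite ler_sqr ?nnegrE// (le_trans u0).
  suff : ((lam * huber_at T0 (A w)) ^+ 2 * expR (lam * huber_at T0 (A w)) <= G w)%R by lra.
  rewrite /G -exp2; set s := expR (_ / 2) in h1 h2 e0 *.
  apply: (@le_trans _ _ ((lam ^+ 2 * kap ^+ 4 * (96 * s)) * s)%R); last by lra.
  apply: ler_pM => //; first exact: sqr_ge0.
  by apply: (le_trans h3); apply: ler_wpM2l => //; lra.
have ml : measurable_fun setT (fun w => lam / 2 * A w ^+ 2)%R.
  by apply: measurable_funM => //; exact: measurable_funX.
have l20 w : (0 <= lam / 2 * A w ^+ 2)%R by rewrite mulr_ge0 ?sqr_ge0 ?divr_ge0//.
apply: (@le_trans _ _ 'E_P[fun w => (1 + lam / 2 * A w ^+ 2 + G w)%R]).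
  apply: ge0_expectation_le => //.
  - by apply: measurableT_comp => //; exact: measurable_funM.
  - by apply: measurable_funD => //; exact: measurable_funD.
rewrite ge0_expectationD//; last 2 first.
- exact: measurable_funD.
- by move=> w; rewrite addr_ge0.
rewrite ge0_expectationD// expectation_const ge0_expectationZl ?mulr_ge0//; last 2 first.
- exact: measurable_funX.
- by move=> w; exact: sqr_ge0.
rewrite Em2; have EG := Escale c0.
have -> : (1 + lam * m2 / 2 + 192 * lam ^+ 2 * kap ^+ 4 =
  1 + lam / 2 * m2 + 2 * (96 * lam ^+ 2 * kap ^+ 4))%R by ring.
by rewrite -EFinM -EFinD [leRHS]EFinD leeD2l.
Qed.

(** For y >= 0 one has exp(-y) <= 1 - y + y^2, so the lower tail puts no upper limit on lam. The
    fourth moment, at most 24 kap^4, enters with weight 1 / (4 T0^2) as truncation bias and again in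
    the second-order term. *)
Lemma expectation_expRN_clip lam T0 m2 : (0 < T0)%R -> (0 <= lam)%R ->
  'E_P[fun w => (A w ^+ 2)%R] = m2%:E ->
  'E_P[fun w => expR (- (lam * clip T0 (A w) ^+ 2))] <=
  (1 - lam * (m2 - 6 * kap ^+ 4 / T0 ^+ 2) + 24 * lam ^+ 2 * kap ^+ 4)%:E.
Proof.
move=> T00 lam0 Em2.
pose c := (lam / (4 * T0 ^+ 2) + lam ^+ 2)%R.
have k4 : (0 <= kap ^+ 4)%R by exact: exprn_even_ge0.
have c0 : (0 <= c)%R by rewrite addr_ge0 ?sqr_ge0// divr_ge0 1?mulr_ge0 ?sqr_ge0//.
pose F w := expR (- (lam * clip T0 (A w) ^+ 2)).
pose G w := (24 * c * kap ^+ 4 * expR (`|A w| / kap))%R.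
have mG : measurable_fun setT G by exact: measurable_funM.
have cc0 : (0 <= 24 * c * kap ^+ 4)%R by rewrite mulr_ge0// mulr_ge0.
have G0 w : (0 <= G w)%R by rewrite mulr_ge0// expR_ge0.
have mF : measurable_fun setT F.
  apply: measurableT_comp => //; apply: measurableT_comp => //.
  apply: measurable_funM => //; apply: measurable_funX.
  by apply: measurableT_comp => //; exact: measurable_clip.
have ml : measurable_fun setT (fun w => lam * A w ^+ 2)%R.
  by apply: measurable_funM => //; exact: measurable_funX.
have l20 w : (0 <= lam * A w ^+ 2)%R by rewrite mulr_ge0 ?sqr_ge0//.
(* Both sides are sums of nonnegative terms, so expectations split without integrability. The last
   term on the left is the constant 1 of the exponential series; it lowers the fourth moment bound
   from 48 to 24 times kap^4. *)
have bnd w : (F w + lam * A w ^+ 2 + 24 * c * kap ^+ 4 <= 1 + G w)%R.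
  have h4 : (A w ^+ 4 + 24 * kap ^+ 4 <= 24 * kap ^+ 4 * expR (`|A w| / kap))%R.
    have := @expR_ge1Dxn R _ 3 (t0 w).
    rewrite (_ : 4`! = 24)%N// => h.
    have -> : (A w ^+ 4 + 24 * kap ^+ 4 = 24 * kap ^+ 4 * (1 + (`|A w| / kap) ^+ 4 / 24))%R.
      by rewrite (exprM (A w) 2 2) sqrA; field; exact: lt0r_neq0.
    by rewrite ler_wpM2l// mulr_ge0.
  have z1 := sqr_clip_ge (A w) T00; have z2 := sqr_clip_le_sqr (A w) (ltW T00).
  have z0 := sqr_ge0 (clip T0 (A w)).
  set Z := (clip T0 (A w) ^+ 2)%R in z0 z1 z2.
  have : (F w <= 1 - lam * Z + lam ^+ 2 * A w ^+ 4)%R.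
    rewrite /F -/Z; set y := (lam * Z)%R.
    have y0 : (0 <= y)%R by rewrite mulr_ge0.
    have y4 : (y ^+ 2 <= lam ^+ 2 * A w ^+ 4)%R.
      rewrite /y exprMn ler_wpM2l ?sqr_ge0// (exprM (A w) 2 2).
      by rewrite ler_sqr ?nnegrE ?sqr_ge0.
    suff : (expR (- y) <= 1 - y + y ^+ 2)%R by lra.
    have e2 := expR_ge1Dx (- y).
    have e3 : (expR y * expR (- y) = 1)%R by rewrite expRxMexpNx_1.
    have e5 := ler_wpM2l (expR_ge0 (- y)) (expR_ge1Dx y).
    have e6 := ler_wpM2l y0 e2.
    lra.
  have := ler_wpM2l lam0 z1.
  have := ler_wpM2l c0 h4.
  rewrite /G /c; lra.
have EF : 'E_P[fun w => (F w + lam * A w ^+ 2 + 24 * c * kap ^+ 4)%R] =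
    'E_P[F] + (lam * m2 + 24 * c * kap ^+ 4)%:E.
  rewrite ge0_expectationD//; last 2 first.
  - exact: measurable_funD.
  - by move=> w; rewrite addr_ge0// expR_ge0.
  rewrite ge0_expectationD//; last by move=> w; exact: expR_ge0.
  rewrite expectation_const ge0_expectationZl//; last 2 first.
  - exact: measurable_funX.
  - by move=> w; exact: sqr_ge0.
  by rewrite Em2 -EFinM -addeA -EFinD.
have EG : 'E_P[fun w => (1 + G w)%R] <= (1 + 48 * c * kap ^+ 4)%:E.
  rewrite ge0_expectationD// expectation_const EFinD leeD2l//.
  by apply: (le_trans (Escale cc0)); rewrite lee_fin; lra.
have : 'E_P[F] + (lam * m2 + 24 * c * kap ^+ 4)%:E <= (1 + 48 * c * kap ^+ 4)%:E.
  rewrite -EF; apply: le_trans EG; apply: ge0_expectation_le => //.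
  - by apply: measurable_funD => //; exact: measurable_funD.
  - exact: measurable_funD.
  - by move=> w; rewrite !addr_ge0// expR_ge0.
rewrite -leeBrDr// -EFinB => /le_trans; apply; rewrite lee_fin /c.
have -> : (6 * kap ^+ 4 / T0 ^+ 2 = 24 * (kap ^+ 4 * (1 / (4 * T0 ^+ 2))))%R.
  by field; exact: lt0r_neq0.
have -> : (lam / (4 * T0 ^+ 2) = lam * (1 / (4 * T0 ^+ 2)))%R.
  by field; exact: lt0r_neq0.
lra.
Qed.

(** Applied to a coordinate of an isotropic vector, this bounds the sub-exponential constant from
    below. *)
Lemma sqr_moment_le m2 : 'E_P[fun w => (A w ^+ 2)%R] = m2%:E -> (m2 <= 2 * kap ^+ 2)%R.
Proof.
move=> Em2.
suff : 'E_P[fun w => (A w ^+ 2 + 2 * kap ^+ 2)%R] <= (4 * kap ^+ 2)%:E.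
  rewrite ge0_expectationD//; last 3 first.
  - exact: measurable_funX.
  - by move=> w; exact: sqr_ge0.
  - by move=> w; rewrite mulr_ge0// sqr_ge0.
  by rewrite Em2 expectation_const -EFinD lee_fin; lra.
have k0 : (0 <= 2 * kap ^+ 2)%R by rewrite mulr_ge0// sqr_ge0.
apply: (@le_trans _ _ 'E_P[fun w => (2 * kap ^+ 2 * expR (`|A w| / kap))%R]).
  apply: ge0_expectation_le => //.
  - by apply: measurable_funD => //; exact: measurable_funX.
  - exact: measurable_funM.
  - by move=> w; rewrite addr_ge0// sqr_ge0.
  - move=> w; have := @expR_ge1Dxn R _ 1 (t0 w); rewrite (_ : 2`! = 2)%N// => h.
    have -> : (A w ^+ 2 + 2 * kap ^+ 2 = 2 * kap ^+ 2 * (1 + (`|A w| / kap) ^+ 2 / 2))%R.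
      by rewrite sqrA; field; exact: lt0r_neq0.
    exact: ler_wpM2l.
by apply: (le_trans (Escale k0)); rewrite lee_fin; lra.
Qed.

End exponential_moments.

(** * Moment generating functions of sums over the sample *)

Section sample_mgf.
Local Open Scope ereal_scope.
Context {disp : measure_display} {T : measurableType disp} {R : realType}.
Variable P : probability T R.
Variables (n d : nat).
Variables (x : 'I_n -> {RV P >-> d.-tuple R}) (xi : 'I_n -> {RV P >-> R}).
Variables (L K sigma : R).
Hypotheses (ix : mutually_independent P x) (ixi : mutually_independent P xi)
  (ixxi : independent_families P x xi)
  (sx : forall i, subexponential P L (x i))
  (cx : forall i, centered P (x i)) (isox : forall i, isotropic P (x i))
  (L0 : (0 < L)%R) (LK : (L < K)%R)
  (sxi : forall i, 'E_P[fun w => (xi i w ^+ 2)%R] <= (sigma ^+ 2)%:E).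

(** The product step of Chernoff's method when noise and design are coupled: once each factor is
    dominated by two products of a function of [xi i] and a function of [x i], independence acts on
    every monomial. *)
Lemma expectation_prod_bool_le (w : bool -> d.-tuple R -> R) (u : bool -> R -> R)
    (F : T -> R) (c : R) :
  (forall j, measurable_fun setT (w j)) -> (forall j t, 0 <= w j t)%R ->
  (forall j, measurable_fun setT (u j)) -> (forall j t, 0 <= u j t)%R ->
  (forall i j, 'E_P[u j \o xi i] \is a fin_num) ->
  (forall i j, 'E_P[w j \o x i] \is a fin_num) ->
  (forall i, 'E_P[u true \o xi i] * 'E_P[w true \o x i] +
     'E_P[u false \o xi i] * 'E_P[w false \o x i] <= (expR c)%:E) ->
  measurable_fun setT F -> (forall t, 0 <= F t)%R ->
  (forall t, F t <= \prod_i (u true (xi i t) * w true (x i t) +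
                            u false (xi i t) * w false (x i t)))%R ->
  'E_P[F] <= (expR (n%:R * c))%:E.
Proof.
move=> mw w0 mu u0 fu fw huw mF F0 hF.
have mt i : measurable_fun setT (fun t => u true (xi i t) * w true (x i t) +
    u false (xi i t) * w false (x i t))%R.
  by apply: measurable_funD; apply: measurable_funM; exact: measurableT_comp.
apply: (@le_trans _ _ 'E_P[fun t => (\prod_i \sum_j (u j (xi i t) * w j (x i t)))%R]).
  apply: ge0_expectation_le => //.
  - by apply: measurable_prod => i _; under eq_fun do rewrite big_bool; exact: mt.
  - by move=> t; apply: (le_trans (hF t)); under [in leRHS]eq_bigr do rewrite big_bool.
rewrite (@expectation_prod_families_sum _ _ _ _ _ _ _ P n x xi ix ixi ixxi _ w u
  (fun i j => fine 'E_P[u j \o xi i]) (fun i j => fine 'E_P[w j \o x i]))//; last 2 first.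
- by move=> i j; rewrite fineK.
- by move=> i j; rewrite fineK.
rewrite lee_fin expRM_natl -[n in leRHS]card_ord -prodr_const.
apply: ler_prod => i _; rewrite big_bool/=.
rewrite addr_ge0 ?mulr_ge0 ?fine_ge0 ?expectation_ge0//=.
by rewrite -lee_fin EFinD !EFinM !fineK.
Qed.

Let mlin v : measurable_fun setT (fun t : d.-tuple R => inner (vec t) v).
Proof. exact: measurable_inner. Qed.

Let mlinx i v : measurable_fun setT (fun t => inner (vec (x i t)) v).
Proof. exact: (measurableT_comp (mlin v)). Qed.

Let K0 : (0 < K)%R.
Proof. exact: lt_trans LK. Qed.

Lemma fin_num_expectation_le (f : T -> R) (c : R) :
  (forall t, 0 <= f t)%R -> 'E_P[f] <= c%:E -> 'E_P[f] \is a fin_num.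
Proof.
move=> f0 h; rewrite ge0_fin_numE; first by apply: le_lt_trans h _; rewrite ltry.
exact: expectation_ge0.
Qed.

Lemma expectation_bounded (f : T -> R) (c : R) : measurable_fun setT f ->
  (forall t, 0 <= f t <= c)%R -> 'E_P[f] <= c%:E.
Proof.
move=> mf h; rewrite -(expectation_const P); apply: ge0_expectation_le => // t;
  by case/andP: (h t).
Qed.

(* exp(lam h a) is at most the mixture of exp(lam a) and exp(-lam a) with weights
   (1 + h)/2 and (1 - h)/2, so that each factor becomes a sum of two products of a
   function of xi i and a function of x i. *)
Lemma expectation_expR_gradient (h : R -> R) (nu lam : R) v :
  measurable_fun setT h -> (forall t, `|h t| <= 1)%R ->
  (0 < nu)%R -> (norm2 v <= nu)%R -> (`|lam| * (K * nu) <= 2^-1)%R ->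
  'E_P[fun t => expR (lam * \sum_i h (xi i t) * inner (vec (x i t)) v)] <=
  (expR (n%:R * (16 * lam ^+ 2 * (K * nu) ^+ 2)))%:E.
Proof.
move=> mh h1 nu0 vnu hlam.
pose s (j : bool) : R := if j then 1%R else (-1)%R.
pose u j t := ((1 + s j * h t) / 2)%R.
pose w j (t : d.-tuple R) := expR ((s j * lam) * inner (vec t) v).
have u0 j t : (0 <= u j t)%R.
  have := h1 t; rewrite ler_norml => /andP[]; rewrite /u /s; case: j; lra.
have mu j : measurable_fun setT (u j).
  by apply: measurable_funM => //; apply: measurable_funD => //; exact: measurable_funM.
have mw j : measurable_fun setT (w j).
  by apply: measurableT_comp => //; exact: measurable_funM.
have w0 j t : (0 <= w j t)%R by exact: expR_ge0.
have wle i j : 'E_P[w j \o x i] <= (1 + 16 * lam ^+ 2 * (K * nu) ^+ 2)%:E.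
  have -> : (1 + 16 * lam ^+ 2 * (K * nu) ^+ 2 =
     1 + 16 * (s j * lam) ^+ 2 * (K * nu) ^+ 2)%R by rewrite /s; case: (j); ring.
  apply: (@expectation_expR_centered _ _ _ _ (fun t => inner (vec (x i t)) v)) => //.
  - exact: mulr_gt0.
  - exact: (subexponential_expR _ _ (sx i)).
  - exact: integrable_inner.
  - exact: expectation_inner.
  - by rewrite normrM (_ : `|s j| = 1)%R ?mul1r// /s; case: (j); rewrite ?normrN normr1.
have fw i j : 'E_P[w j \o x i] \is a fin_num by apply: fin_num_expectation_le (wle i j) => t; exact: w0.
have mux i j : measurable_fun setT (u j \o xi i) by exact: measurableT_comp.
have ule i j : 'E_P[u j \o xi i] <= 1%:E.
  apply: expectation_bounded => // t; rewrite u0 /=.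
  have := h1 (xi i t); rewrite ler_norml => /andP[]; rewrite /u /s; case: (j); lra.
have fu i j : 'E_P[u j \o xi i] \is a fin_num by apply: fin_num_expectation_le (ule i j) => t; exact: u0.
apply: (@expectation_prod_bool_le w u) => //.
- move=> i; set B := (16 * lam ^+ 2 * (K * nu) ^+ 2)%R in wle *.
  apply: (@le_trans _ _ (1 + B)%:E); last by rewrite lee_fin expR_ge1Dx.
  apply: (@le_trans _ _ (('E_P[u true \o xi i] + 'E_P[u false \o xi i]) * (1 + B)%:E)).
    have Eu0 j : 0 <= 'E_P[u j \o xi i] by apply: expectation_ge0 => t; exact: u0.
    by rewrite ge0_muleDl//; apply: leeD; apply: lee_wpmul2l => //; exact: wle.
  rewrite -ge0_expectationD//=.
  have -> : (fun t => (u true (xi i t) + u false (xi i t))%R) = (fun=> 1%R).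
    by apply/funext => t; rewrite /u /s; field.
  by rewrite expectation_const mul1e.
- apply: measurableT_comp => //; apply: measurable_funM => //.
  apply: measurable_sum => i; apply: measurable_funM => //.
  exact: measurableT_comp.
- move=> t; rewrite mulr_sumr expR_sum; apply: ler_prod => i _.
  rewrite expR_ge0/=; set a := inner _ _.
  have hi := u0 true (xi i t); have hi' := u0 false (xi i t).
  have e12 : (u true (xi i t) + u false (xi i t) = 1)%R by rewrite /u /s; field.
  rewrite /w -/a /= !mul1r mulN1r.
  have -> : (lam * (h (xi i t) * a) = u true (xi i t) * (lam * a) + u false (xi i t) * (- lam * a))%R.
    by rewrite /u /s; field.
  set p := u true _ in hi e12 *; set q := u false _ in hi' e12 *.
  set c := (p * (lam * a) + q * (- lam * a))%R.
  (* Convexity of exp through its tangent at the barycenter [c]: the two tangent bounds, weighted by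
     [p] and [q], add up to exp c. *)
  have t1 : (expR c * (1 + (lam * a - c)) <= expR (lam * a))%R.
    by rewrite -[in leRHS](subrK c (lam * a)%R) [leRHS]expRD [leLHS]mulrC ler_wpM2r ?expR_ge0 ?expR_ge1Dx.
  have t2 : (expR c * (1 + (- lam * a - c)) <= expR (- lam * a))%R.
    by rewrite -[in leRHS](subrK c (- lam * a)%R) [leRHS]expRD [leLHS]mulrC ler_wpM2r ?expR_ge0 ?expR_ge1Dx.
  have := ler_wpM2l hi t1; have := ler_wpM2l hi' t2.
  have : (p * (expR c * (1 + (lam * a - c))) + q * (expR c * (1 + (- lam * a - c))) =
    expR c * ((p + q) * (1 - c) + c))%R by rewrite /c; ring.
  by rewrite e12; lra.
Qed.

Lemma expectation_expR_huber_at_sum (T0 nu lam : R) v :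
  (0 <= T0)%R -> (0 <= lam)%R ->
  (0 < nu)%R -> (norm2 v <= nu)%R -> (lam * T0 * (K * nu) <= 2^-1)%R ->
  'E_P[fun t => expR (lam * \sum_i huber_at T0 (inner (vec (x i t)) v))] <=
  (expR (n%:R * (lam * nu ^+ 2 / 2 + 192 * lam ^+ 2 * (K * nu) ^+ 4)))%:E.
Proof.
move=> T00 lam0 nu0 vnu hlam.
pose w (j : bool) (t : d.-tuple R) := expR (lam * huber_at T0 (inner (vec t) v)).
pose u (j : bool) (t : R) : R := j%:R.
have mw j : measurable_fun setT (w j).
  apply: measurableT_comp => //; apply: measurable_funM => //.
  by apply: (measurableT_comp (measurable_huber_at T0)); exact: mlin.
have w0 j t : (0 <= w j t)%R by exact: expR_ge0.
have wle i j : 'E_P[w j \o x i] <= (1 + lam * nu ^+ 2 / 2 + 192 * lam ^+ 2 * (K * nu) ^+ 4)%:E.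
  apply: (@le_trans _ _ (1 + lam * (norm2 v ^+ 2) / 2 + 192 * lam ^+ 2 * (K * nu) ^+ 4)%:E).
    apply: (@expectation_expR_huber_at _ _ _ _ (fun t => inner (vec (x i t)) v)) => //.
    - exact: mulr_gt0.
    - exact: (subexponential_expR _ _ (sx i)).
    - exact: expectation_inner_sqr.
  rewrite lee_fin lerD2r lerD2l ler_pM2r// ler_wpM2l//.
  by rewrite ler_sqr ?nnegrE ?norm2_ge0// ltW.
have fw i j : 'E_P[w j \o x i] \is a fin_num by apply: fin_num_expectation_le (wle i j) => t; exact: w0.
have eu i j : 'E_P[u j \o xi i] = (j%:R)%:E by exact: expectation_const.
apply: (@expectation_prod_bool_le w u) => //.
- by move=> j; exact: measurable_cst.
- by move=> i j; rewrite eu.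
- move=> i; rewrite !eu mul1e mul0e adde0; apply: (le_trans (wle i true)).
  by rewrite lee_fin -addrA expR_ge1Dx.
- apply: measurableT_comp => //; apply: measurable_funM => //.
  apply: measurable_sum => i.
  by apply: (measurableT_comp (measurable_huber_at T0)).
- move=> t; rewrite mulr_sumr expR_sum; apply: ler_prod => i _.
  by rewrite expR_ge0/= /u /w mul1r mul0r addr0.
Qed.

(** Each factor equals exp(- lam clip^2) where |xi| <= T0 and 1 elsewhere. Chebyshev bounds the
    second case by sigma^2 / T0^2, the loss in front of [norm2 v ^+ 2]. The main term keeps
    [norm2 v] because a lower bound is sought; only error terms use [nu]. *)
Lemma expectation_expRN_clip_sum (T0 nu lam : R) v :
  (0 < T0)%R -> (0 <= lam)%R -> (0 < nu)%R -> (norm2 v <= nu)%R ->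
  'E_P[fun t => expR (- (lam * \sum_(i | (`|xi i t| <= T0)%R) clip T0 (inner (vec (x i t)) v) ^+ 2))] <=
  (expR (n%:R * (- lam * ((1 - sigma ^+ 2 / T0 ^+ 2) * norm2 v ^+ 2 - 6 * (K * nu) ^+ 4 / T0 ^+ 2)
     + 24 * lam ^+ 2 * (K * nu) ^+ 4)))%:E.
Proof.
move=> T00 lam0 nu0 vnu.
pose w (j : bool) (t : d.-tuple R) : R :=
  if j then expR (- (lam * clip T0 (inner (vec t) v) ^+ 2)) else 1%R.
pose S := [set t : R | `|t| <= T0]%R.
pose u (j : bool) (t : R) : R := if j then \1_S t else \1_(~` S) t.
have mS : measurable S.
  rewrite (_ : S = `[(- T0)%R, T0]%classic)//.
  by apply/seteqP; split => t /=; rewrite /S /= in_itv /= ler_norml.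
have mw j : measurable_fun setT (w j).
  rewrite /w; case: j => //.
  apply: measurableT_comp => //; apply: measurableT_comp => //; apply: measurable_funM => //.
  apply: measurable_funX.
  by apply: (measurableT_comp (measurable_clip T0)); exact: mlin.
have w0 j t : (0 <= w j t)%R by rewrite /w; case: j => //; exact: expR_ge0.
have mu j : measurable_fun setT (u j).
  by rewrite /u; case: j; apply: measurable_indic => //; exact: measurableC.
have u0 j t : (0 <= u j t)%R by rewrite /u; case: j.
have mux i j : measurable_fun setT (u j \o xi i) by exact: measurableT_comp.
have ule i j : 'E_P[u j \o xi i] <= 1%:E.
  by apply: expectation_bounded => // t; rewrite u0 /= /u; case: j; rewrite indicE; case: (_ \in _).
have fu i j : 'E_P[u j \o xi i] \is a fin_num by apply: fin_num_expectation_le (ule i j) => t; exact: u0.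
have mwx i j : measurable_fun setT (w j \o x i) by exact: measurableT_comp.
have wle i j : 'E_P[w j \o x i] <= 1%:E.
  apply: expectation_bounded => // t; rewrite w0 /= /w; case: j => //=.
  by rewrite expR_le1 oppr_le0 mulr_ge0// sqr_ge0.
have fw i j : 'E_P[w j \o x i] \is a fin_num by apply: fin_num_expectation_le (wle i j) => t; exact: w0.
set D := (6 * (K * nu) ^+ 4 / T0 ^+ 2)%R.
have D0 : (0 <= D)%R.
  by rewrite divr_ge0 ?sqr_ge0// mulr_ge0// exprn_even_ge0.
apply: (@expectation_prod_bool_le w u) => //.
- move=> i.
  have usum : (fine 'E_P[u true \o xi i] + fine 'E_P[u false \o xi i] = 1)%R.
    apply: EFin_inj; rewrite EFinD !fineK// -ge0_expectationD//=.
    have -> : (fun t => (u true (xi i t) + u false (xi i t))%R) = (fun=> 1%R).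
      apply/funext => t; rewrite /u !indicE in_setC; case: (_ \in _) => /=; ring.
    exact: expectation_const.
  have ufalse : (fine 'E_P[u false \o xi i] <= sigma ^+ 2 / T0 ^+ 2)%R.
    rewrite ler_pdivlMr ?exprn_gt0// mulrC -lee_fin EFinM fineK//.
    rewrite -ge0_expectationZl//; last by rewrite sqr_ge0.
    apply: le_trans (sxi i); apply: ge0_expectation_le => //.
    + exact: measurable_funM.
    + exact: measurable_funX.
    + by move=> t; rewrite mulr_ge0// sqr_ge0.
    + move=> t; rewrite /= /u indicE; case: (boolP (_ \in _)); last first.
        by rewrite mulr0 sqr_ge0.
      rewrite mulr1 inE /S /= => /negP; rewrite -ltNge => hT.
      rewrite -[leRHS](real_normK (num_real _)) ler_sqr ?nnegrE ?ltW//.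
      exact: lt_trans hT.
  have wf : 'E_P[w false \o x i] = 1 by exact: expectation_const.
  have wt : (fine 'E_P[w true \o x i] <= 1 - lam * (norm2 v ^+ 2 - D) + 24 * lam ^+ 2 * (K * nu) ^+ 4)%R.
    rewrite -lee_fin fineK//.
    apply: (@expectation_expRN_clip _ _ _ _ (fun t => inner (vec (x i t)) v)) => //.
    - exact: mulr_gt0.
    - exact: (subexponential_expR _ _ (sx i)).
    - exact: expectation_inner_sqr.
  rewrite wf mule1 -(fineK (fu i true)) -(fineK (fu i false)) -(fineK (fw i true)).
  rewrite -EFinM -EFinD lee_fin; apply: le_trans (expR_ge1Dx _).
  have a0 : (0 <= fine 'E_P[u true \o xi i])%R by rewrite fine_ge0// expectation_ge0.
  have a1 : (fine 'E_P[u true \o xi i] <= 1)%R by rewrite -lee_fin fineK.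
  move: (fine 'E_P[u true \o xi i]) (fine 'E_P[u false \o xi i])
    (fine 'E_P[w true \o x i]) usum ufalse wt a0 a1 => a a' b usum ufalse wt a0 a1.
  have := ler_wpM2l a0 wt.
  set M := (24 * lam ^+ 2 * (K * nu) ^+ 4)%R.
  have M0 : (0 <= M)%R.
    by apply: mulr_ge0; [rewrite mulr_ge0// sqr_ge0|exact: exprn_even_ge0].
  have : (a * M <= M)%R by rewrite ler_piMl.
  have : (lam * (a * D) <= lam * D)%R by rewrite ler_wpM2l// ler_piMl.
  have : (lam * ((1 - sigma ^+ 2 / T0 ^+ 2) * norm2 v ^+ 2) <= lam * (a * norm2 v ^+ 2))%R.
    by rewrite ler_wpM2l// ler_wpM2r ?sqr_ge0//; lra.
  lra.
- apply: measurableT_comp => //; apply: measurableT_comp => //.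
  apply: measurable_funM => //.
  under eq_fun do rewrite big_mkcond/=.
  apply: measurable_sum => i.
  rewrite (_ : (fun t => _) = (fun t => (u true (xi i t) * clip T0 (inner (vec (x i t)) v) ^+ 2)%R)).
    apply: measurable_funM; first exact: mux.
    by apply: measurable_funX; apply: (measurableT_comp (measurable_clip T0)).
  apply/funext => t; rewrite /u indicE; case: ifPn => hT; first by rewrite mem_set// mul1r.
  by rewrite memNset ?mul0r//; exact/negP.
- move=> t; rewrite big_mkcond mulr_sumr -sumrN expR_sum; apply: ler_prod => i _.
  rewrite expR_ge0/= /u /w mulr1 !indicE in_setC; case: ifPn => hT.
    by rewrite mem_set//= mul1r addr0.
  by rewrite memNset ?mul0r ?mulr0 ?oppr0 ?expR0 ?add0r//; exact/negP.
Qed.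

End sample_mgf.

(** * Integer grid vectors and duality *)

Section grid.
Context {R : realType} {d : nat}.
Implicit Types (u v w G : 'rV[R]_d) (k : 'I_d -> int).

Definition intvec k : 'rV[R]_d := \row_j (k j)%:~R.

Lemma round_toward0 (t : R) : exists k : int,
  `|k%:~R| <= `|t| /\ `|t - k%:~R| <= Num.min 1 `|t|.
Proof.
wlog t0 : t / 0 <= t.
  move=> H; have [/H//|t0] := leP 0 t.
  have [|k [h1 h2]] := H (- t); first by rewrite oppr_ge0 ltW.
  exists (- k); rewrite mulrNz normrN opprK.
  by rewrite normrN in h1 h2; split => //; rewrite -normrN opprD; exact: h2.
exists (Num.floor t); have h1 := floor_le t; have h2 := floorD1_gt t.
rewrite intrD1 in h2.
have h0 : 0 <= (Num.floor t)%:~R :> R by rewrite ler0z floor_ge0.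
rewrite !ger0_norm ?subr_ge0//; split => //.
by rewrite le_min; apply/andP; split; lra.
Qed.

Lemma innerDr G u v : inner G (u + v) = inner G u + inner G v.
Proof. by rewrite /inner -big_split/=; apply: eq_bigr => j _; rewrite mxE mulrDr. Qed.

Lemma innerZr G a v : inner G (a *: v) = a * inner G v.
Proof. by rewrite /inner mulr_sumr; apply: eq_bigr => j _; rewrite mxE mulrCA. Qed.

Lemma norm2Z a v : norm2 (a *: v) = `|a| * norm2 v.
Proof.
rewrite /norm2; under eq_bigr do rewrite mxE exprMn.
by rewrite -mulr_sumr sqrtrM ?sqr_ge0// sqrtr_sqr.
Qed.

Lemma norm1Z a v : norm1 (a *: v) = `|a| * norm1 v.
Proof.
by rewrite /norm1 mulr_sumr; apply: eq_bigr => j _; rewrite mxE normrM.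
Qed.

Lemma norm1_ge0 v : 0 <= norm1 v.
Proof. exact: sumr_ge0. Qed.

Lemma norm1D u v : norm1 (u + v) <= norm1 u + norm1 v.
Proof.
by rewrite /norm1 -big_split/=; apply: ler_sum => j _; rewrite mxE ler_normD.
Qed.

(** Cauchy-Schwarz, by summing (a_i b_j - a_j b_i)^2 >= 0 over all pairs. *)
Lemma sum_mul_le (I : finType) (J : {pred I}) (a b : I -> R) :
  (\sum_(j in J) a j * b j) ^+ 2 <= (\sum_(j in J) a j ^+ 2) * (\sum_(j in J) b j ^+ 2).
Proof.
have e1 : (\sum_(j in J) a j * b j) ^+ 2 =
    \sum_(i in J) \sum_(j in J) (a i * b i) * (a j * b j).
  by rewrite expr2 mulr_suml; apply: eq_bigr => i _; rewrite mulr_sumr.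
have e2 : (\sum_(j in J) a j ^+ 2) * (\sum_(j in J) b j ^+ 2) =
    \sum_(i in J) \sum_(j in J) a i ^+ 2 * b j ^+ 2.
  by rewrite mulr_suml; apply: eq_bigr => i _; rewrite mulr_sumr.
have e3 : (\sum_(j in J) a j ^+ 2) * (\sum_(j in J) b j ^+ 2) =
    \sum_(i in J) \sum_(j in J) a j ^+ 2 * b i ^+ 2 by rewrite e2 exchange_big.
suff : 2 * (\sum_(j in J) a j * b j) ^+ 2 <=
    (\sum_(j in J) a j ^+ 2) * (\sum_(j in J) b j ^+ 2) +
    (\sum_(j in J) a j ^+ 2) * (\sum_(j in J) b j ^+ 2) by lra.
rewrite {1}e2 e3 e1 mulr_sumr -big_split/=; apply: ler_sum => i _.
rewrite mulr_sumr -big_split/=; apply: ler_sum => j _.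
by have := sqr_ge0 (a i * b j - a j * b i); lra.
Qed.

Lemma sum_norm_le (J : {set 'I_d}) v :
  (\sum_(j in J) `|v 0 j|) ^+ 2 <= #|J|%:R * \sum_(j in J) v 0 j ^+ 2.
Proof.
have := sum_mul_le (mem J) (fun j => `|v 0 j|) (fun=> 1).
under eq_bigr do rewrite mulr1.
move=> /le_trans; apply; rewrite [leRHS]mulrC.
under eq_bigr do rewrite real_normK ?num_real//.
have -> : \sum_(j in mem J) (1 : R) ^+ 2 = #|J|%:R.
  by rewrite -sumr_const; apply: eq_bigr => j _; rewrite expr1n.
exact: lexx.
Qed.

(* Duality for the norm |v|_2 + |v|_1 / sqrt S: the coordinates of G above
   M / sqrt S are at most S in number, and rounding a multiple of that part of
   G bounds its Euclidean norm by M. *)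
Lemma inner_le_of_grid (S M : R) G : 1 <= S ->
  (forall k, norm2 (intvec k) ^+ 2 <= 4 * S -> inner G (intvec k) <= Num.sqrt S * M) ->
  forall v, inner G v <= M * (norm2 v + norm1 v / Num.sqrt S).
Proof.
move=> S1 H v.
have S0 : 0 < S by lra.
have q0 : 0 < Num.sqrt S by rewrite sqrtr_gt0.
have qq : Num.sqrt S ^+ 2 = S by rewrite sqr_sqrtr// ltW.
have M0 : 0 <= M.
  have := H (fun=> 0); rewrite sqr_norm2.
  rewrite big1 => [|j _]; last by rewrite mxE mulr0z expr0n.
  rewrite /inner big1 => [|j _]; last by rewrite mxE mulr0z mulr0.
  move=> h; have {h} : 0 <= Num.sqrt S * M by apply: h; lra.
  by rewrite pmulr_rge0.
have Mq : 0 <= M / Num.sqrt S by rewrite divr_ge0// ltW.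
pose J := [set j | M / Num.sqrt S < `|G 0 j|]%SET.
have JS : #|J|%:R <= S.
  rewrite leNgt; apply/negP => SJ.
  (* The least integer above S. The sign vector of p coordinates of [J] has squared norm at most p
     <= S + 1 <= 4 S, yet its product with [G] exceeds p M / sqrt S > sqrt S M, against [H]. *)
  pose p := (Num.truncn S).+1.
  have pS : S < p%:R by exact: truncnS_gt.
  have pS1 : p%:R <= S + 1 by rewrite /p -natr1 lerD2r truncn_le// ltW.
  have pJ : (p <= #|J|)%N.
    rewrite /p -(ltr_nat R); apply: le_lt_trans SJ.
    by rewrite truncn_le// ltW.
  have [J' J'J cJ'] : exists2 J' : {set 'I_d}, J' \subset J & #|J'| = p.
    exists [set x in take p (enum J)]%SET.
      apply/fintype.subsetP => j; rewrite inE => /mem_take; by rewrite mem_enum.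
    rewrite cardsE (card_uniqP _) ?take_uniq ?enum_uniq// size_takel//.
    by rewrite -cardE.
  pose k j : int := if j \in J' then sgz (G 0 j) else 0.
  have kE j : (k j)%:~R = (if j \in J' then Num.sg (G 0 j) else 0) :> R.
    by rewrite /k; case: ifP => _; rewrite ?mulr0z// sgrEz.
  have := H k.
  rewrite sqr_norm2.
  have -> : \sum_j intvec k 0 j ^+ 2 <= 4 * S.
    apply: (@le_trans _ _ (\sum_(j in J') 1)).
      rewrite [leRHS]big_mkcond; apply: ler_sum => j _; rewrite mxE kE.
      case: ifP => _; last by rewrite expr0n.
      by rewrite sqr_sg; case: (_ != 0).
    by rewrite sumr_const cJ'; lra.
  move=> /(_ isT).
  rewrite leNgt => /negP; apply.
  have -> : inner G (intvec k) = \sum_(j in J') `|G 0 j|.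
    rewrite [RHS]big_mkcond; apply: eq_bigr => j _; rewrite mxE kE.
    by case: ifPn => jJ'; rewrite ?mulr0// mulrC -normrEsg.
  apply: (@le_lt_trans _ _ (\sum_(j in J') M / Num.sqrt S)).
    rewrite sumr_const cJ' -[leRHS]mulr_natl.
    have -> : Num.sqrt S * M = Num.sqrt S ^+ 2 * (M / Num.sqrt S).
      by field; exact: lt0r_neq0.
    by rewrite qq; apply: ler_wpM2r => //; exact: ltW.
  apply: ltr_sum => [|j jJ'].
    have [j jJ'] : exists j, j \in J' by apply/set0Pn; rewrite -card_gt0 cJ'.
    by apply/hasP; exists j => //; rewrite mem_index_enum.
  by have /fintype.subsetP/(_ j jJ') := J'J; rewrite inE.
pose g2 := \sum_(j in J) G 0 j ^+ 2.
pose g := Num.sqrt g2.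
have g20 : 0 <= g2 by apply: sumr_ge0 => j _; exact: sqr_ge0.
have gg : g ^+ 2 = g2 by rewrite sqr_sqrtr.
have g0 : 0 <= g by exact: sqrtr_ge0.
have gM : g <= M.
  have [->//|gn0] := eqVneq g 0.
  have gp : 0 < g by rewrite lt_neqAle eq_sym gn0.
  (* On [J] this has norm 2 sqrt S, hence the bound 4 S on the grid. Rounding loses at most the l1
     norm of [G] on [J], which is at most sqrt S g since [J] has at most S elements; of the product
     2 sqrt S g, at least sqrt S g survives. *)
  pose t j := 2 * Num.sqrt S * G 0 j / g.
  pose k j : int := if j \in J then xget 0 [set k : int | `|k%:~R| <= `|t j| /\ `|t j - k%:~R| <= Num.min 1 `|t j|] else 0.
  have kP j : j \in J -> `|(k j)%:~R| <= `|t j| /\ `|t j - (k j)%:~R| <= 1.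
    move=> jJ; rewrite /k jJ; case: xgetP => [y _ [h1]|].
      by rewrite le_min => /andP[h2 _].
    by have [y hy] := round_toward0 (t j) => /(_ y).
  have tE j : t j ^+ 2 = 4 * S * (G 0 j ^+ 2) / g2.
    by rewrite /t -gg -[in RHS]qq; field.
  have := H k; rewrite sqr_norm2.
  have -> : \sum_j intvec k 0 j ^+ 2 <= 4 * S.
    apply: (@le_trans _ _ (\sum_(j in J) t j ^+ 2)).
      rewrite [leRHS]big_mkcond; apply: ler_sum => j _; rewrite mxE.
      case: ifPn => jJ; last by rewrite /k (negbTE jJ) mulr0z expr0n.
      have [h _] := kP j jJ.
      by rewrite -(real_normK (num_real (t j))) -(real_normK (num_real (k j)%:~R)) ler_sqr.
    under eq_bigr do rewrite tE.
    rewrite -mulr_suml -mulr_sumr -/g2 -mulrA divff ?mulr1//.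
    by rewrite -gg sqrf_eq0.
  move=> /(_ isT) h.
  have h1 : \sum_(j in J) (G 0 j * t j - `|G 0 j|) <= inner G (intvec k).
    rewrite [leLHS]big_mkcond; apply: ler_sum => j _; rewrite mxE.
    case: ifPn => jJ; last by rewrite /k (negbTE jJ) mulr0z mulr0.
    have [_ hj] := kP j jJ.
    have := ler_norm (G 0 j * (t j - (k j)%:~R)); rewrite normrM.
    by have := ler_wpM2l (normr_ge0 (G 0 j)) hj; lra.
  have h2 : \sum_(j in J) (G 0 j * t j - `|G 0 j|) =
      2 * Num.sqrt S * g - \sum_(j in J) `|G 0 j|.
    rewrite sumrB; congr (_ - _).
    have -> : 2 * Num.sqrt S * g = (2 * Num.sqrt S / g) * g2 by rewrite -gg; field.
    by rewrite mulr_sumr; apply: eq_bigr => j _; rewrite /t; field.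
  have h3 : \sum_(j in J) `|G 0 j| <= Num.sqrt S * g.
    rewrite -ler_sqr ?nnegrE ?sumr_ge0 ?mulr_ge0 ?sqrtr_ge0//.
    apply: (le_trans (sum_norm_le _ _)); rewrite -/g2 exprMn qq gg.
    exact: ler_wpM2r.
  rewrite -(ler_pM2l q0); lra.
have -> : inner G v = \sum_(j in J) G 0 j * v 0 j + \sum_(j in ~: J) G 0 j * v 0 j.
  rewrite /inner (bigID (mem J))/=; congr (_ + _).
  by apply: eq_bigl => j; rewrite !inE.
rewrite mulrDr; apply: lerD.
  apply: (@le_trans _ _ (g * norm2 v)); last by rewrite ler_wpM2r// norm2_ge0.
  apply: (le_trans (ler_norm _)).
  rewrite -ler_sqr ?nnegrE ?normr_ge0 ?mulr_ge0 ?norm2_ge0// real_normK ?num_real//.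
  apply: (le_trans (sum_mul_le _ _ _)); rewrite exprMn gg sqr_norm2.
  by apply: ler_wpM2l => //; rewrite [leRHS](bigID (mem J))/= lerDl sumr_ge0// => j _; exact: sqr_ge0.
have -> : M * (norm1 v / Num.sqrt S) = \sum_j M / Num.sqrt S * `|v 0 j|.
  by rewrite -mulr_sumr /norm1; ring.
rewrite big_mkcond; apply: ler_sum => j _.
case: ifPn => [|_]; last by rewrite mulr_ge0.
rewrite !inE -leNgt => hj; apply: (le_trans (ler_norm _)); rewrite normrM.
exact: ler_wpM2r.
Qed.

End grid.

(** * Convexity and local strong convexity of the Huber loss *)

Section huber_facts.
Context {R : realType}.
Implicit Types a b t v T : R.

Lemma huberE t : huber t = huber_at 1 t.
Proof.
rewrite /huber /huber_at; case: ifPn => h.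
  have [[h1 ->]|[h1 ->]] := clip_gt ler01 h.
    by rewrite gtr0_norm; lra.
  by rewrite ltr0_norm; lra.
by rewrite -leNgt in h; rewrite clip_id//; field.
Qed.

Lemma huber_tangent a b : huber a + clip 1 a * (b - a) <= huber b.
Proof.
rewrite !huberE; have := young_huber_at b (@ler01 R) (clip_norm a ler01).
by rewrite {2}/huber_at; lra.
Qed.

Lemma huber_convex th a b : 0 <= th <= 1 ->
  huber ((1 - th) * a + th * b) <= (1 - th) * huber a + th * huber b.
Proof.
move=> /andP[t0 t1]; set c := _ + _.
have t1' : 0 <= 1 - th by lra.
have := ler_wpM2l t1' (huber_tangent c a); have := ler_wpM2l t0 (huber_tangent c b).
have : (1 - th) * (huber c + clip 1 c * (a - c)) + th * (huber c + clip 1 c * (b - c)) = huber c.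
  by rewrite {3 6}/c; ring.
lra.
Qed.

(** Fenchel-Young at the dual point t - clip (1/2) v, admissible because both terms are at most 1/2
    in absolute value. Hence noise and linear form are both cut at half the Huber threshold. *)
Lemma huber_strong_tangent t v : `|t| <= 2^-1 ->
  huber t - clip 1 t * v + clip 2^-1 v ^+ 2 / 2 <= huber (t - v).
Proof.
move=> ht; have h2 : 0 <= 2^-1 :> R by [].
have ht1 : `|t| <= 1 by lra.
have hc := clip_norm v h2; have hcv := sqr_clip_le v h2.
have -> : huber t = t ^+ 2 / 2 by rewrite huberE /huber_at clip_id//; field.
have hth : `|t - clip 2^-1 v| <= 1 by apply: (le_trans (ler_normB _ _)); lra.
rewrite huberE clip_id//; have := young_huber_at (t - v) (@ler01 R) hth.
lra.
Qed.

Lemma clipZ c T a : 0 < c -> clip (c * T) (c * a) = c * clip T a.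
Proof.
move=> c0; rewrite /clip; rewrite -mulrN.
by rewrite (maxr_pMr (- T) (Num.min a T) (ltW c0)) (minr_pMr a T (ltW c0)).
Qed.

(** A summand beyond T already contributes T^2, the largest value of the left side; otherwise 2ab <=
    a^2 / 10 + 10 b^2. The weight close to 1 is meant for the main part, the large one for the
    rounding remainder. *)
Lemma sqr_clipD T a b : 0 <= T ->
  clip T (a + b) ^+ 2 <= 11 / 10 * clip T a ^+ 2 + 11 * clip T b ^+ 2.
Proof.
move=> T0; have hab : clip T (a + b) ^+ 2 <= T ^+ 2.
  rewrite -(real_normK (num_real (clip T (a + b)))) ler_sqr ?nnegrE//.
  exact: clip_norm.
have hc c : T < `|c| -> clip T c ^+ 2 = T ^+ 2.
  by move=> h; case: (clip_gt T0 h) => -[_ ->]; rewrite ?sqrrN.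
have [ha|/hc ha] := leP `|a| T; last first.
  by rewrite ha; have := sqr_ge0 (clip T b); have := sqr_ge0 T; lra.
have [hb|/hc hb] := leP `|b| T; last first.
  by rewrite hb; have := sqr_ge0 (clip T a); have := sqr_ge0 T; lra.
rewrite (clip_id ha) (clip_id hb); apply: (le_trans (sqr_clip_le_sqr _ T0)).
by have := sqr_ge0 (a - 10 * b); lra.
Qed.

End huber_facts.

(** * Deterministic inequalities for the Huber lasso objective *)

Section huber_lasso_facts.
Context {R : realType} {n d : nat}.
Variables (X : 'I_n -> 'rV[R]_d) (xi y : 'I_n -> R) (beta : 'rV[R]_d)
  (lambda_o lambda_s : R).
Hypotheses (n0 : (0 < n)%N) (lo0 : 0 < lambda_o) (ls0 : 0 < lambda_s)
  (yE : forall i, y i = inner (X i) beta + xi i).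

Let tau := lambda_o * Num.sqrt n%:R.
Let F := huber_lasso lambda_o lambda_s X y.

Let nR : 0 < n%:R :> R. Proof. by rewrite ltr0n. Qed.

Let tau0 : 0 < tau. Proof. by rewrite mulr_gt0// sqrtr_gt0. Qed.

Let lo2 : lambda_o ^+ 2 = tau ^+ 2 / n%:R.
Proof.
rewrite /tau exprMn sqr_sqrtr; last exact: ltW.
by field; exact: lt0r_neq0.
Qed.

Lemma huber_lasso_shift u : F (beta + u) =
  \sum_i lambda_o ^+ 2 * huber (xi i / tau - inner (X i) u / tau) +
  lambda_s * norm1 (beta + u).
Proof.
congr (_ + _); apply: eq_bigr => i _; congr (_ * huber _).
by rewrite yE innerDr -/tau; field; exact: lt0r_neq0.
Qed.

Lemma huber_lasso_convex v th : 0 <= th <= 1 -> F (beta + v) <= F beta ->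
  F (beta + th *: v) <= F beta.
Proof.
move=> th01; have /andP[t0 t1] := th01.
have F0 := huber_lasso_shift 0; rewrite addr0 in F0.
have i0 i : inner (X i) 0 = 0.
  by rewrite /inner big1// => j _; rewrite mxE mulr0.
rewrite F0 !huber_lasso_shift => h.
have n1 : norm1 (beta + th *: v) <= (1 - th) * norm1 beta + th * norm1 (beta + v).
  have -> : beta + th *: v = (1 - th) *: beta + th *: (beta + v).
    by rewrite scalerDr addrA -scalerDl subrK scale1r.
  by apply: (le_trans (norm1D _ _)); rewrite !norm1Z !ger0_norm ?subr_ge0.
have hs : \sum_i lambda_o ^+ 2 * huber (xi i / tau - inner (X i) (th *: v) / tau) <=
   (1 - th) * (\sum_i lambda_o ^+ 2 * huber (xi i / tau - inner (X i) 0 / tau)) +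
   th * (\sum_i lambda_o ^+ 2 * huber (xi i / tau - inner (X i) v / tau)).
  rewrite !mulr_sumr -big_split/=; apply: ler_sum => i _.
  rewrite innerZr i0 mul0r subr0.
  have := ler_wpM2l (sqr_ge0 lambda_o) (huber_convex (xi i / tau) (xi i / tau - inner (X i) v / tau) th01).
  have -> : (1 - th) * (xi i / tau) + th * (xi i / tau - inner (X i) v / tau) =
    xi i / tau - th * inner (X i) v / tau by ring.
  lra.
have := ler_wpM2l (ltW ls0) n1; have := ler_wpM2l t0 h.
lra.
Qed.

(** Since [clip 1] is the derivative of [huber] and lambda_o^2 = tau^2 / n, the loss part has
    gradient minus tau times this vector at [beta]. *)
Definition huber_gradient : 'rV[R]_d :=
  n%:R^-1 *: \sum_i clip 1 (xi i / tau) *: X i.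

Lemma inner_sumZl (c : 'I_n -> R) (a : R) u :
  inner (a *: \sum_i c i *: X i) u = a * \sum_i c i * inner (X i) u.
Proof.
rewrite /inner mulr_sumr.
under eq_bigr do rewrite mxE summxE mulrAC mulr_sumr.
rewrite exchange_big/=; apply: eq_bigr => i _.
rewrite mulr_sumr mulr_sumr; apply: eq_bigr => j _.
by rewrite mxE; ring.
Qed.

(** Indices with small noise use the strong tangent inequality; the others use the plain one and
    contribute no curvature. *)
Lemma huber_lasso_basic u : F (beta + u) <= F beta ->
  (n%:R^-1 * \sum_(i | `|xi i| <= tau / 2) clip (tau / 2) (inner (X i) u) ^+ 2) / 2 <=
  tau * inner huber_gradient u + lambda_s * (norm1 beta - norm1 (beta + u)).
Proof.
have F0 := huber_lasso_shift 0; rewrite addr0 in F0.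
have i0 i : inner (X i) 0 = 0.
  by rewrite /inner big1// => j _; rewrite mxE mulr0.
rewrite F0 huber_lasso_shift inner_sumZl => h.
suff : n%:R^-1 / 2 * (\sum_(i | `|xi i| <= tau / 2) clip (tau / 2) (inner (X i) u) ^+ 2) -
  tau / n%:R * (\sum_i clip 1 (xi i / tau) * inner (X i) u) <=
  \sum_i lambda_o ^+ 2 * huber (xi i / tau - inner (X i) u / tau) -
  \sum_i lambda_o ^+ 2 * huber (xi i / tau - inner (X i) 0 / tau) by lra.
rewrite big_mkcond !mulr_sumr -!sumrB; apply: ler_sum => i _.
rewrite i0 mul0r subr0 lo2; set a := inner _ _.
have e1 : clip (tau / 2) a ^+ 2 = tau ^+ 2 * clip 2^-1 (a / tau) ^+ 2.
  by rewrite -exprMn -clipZ//; congr (clip _ _ ^+ 2); field; exact: lt0r_neq0.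
have -> : tau / n%:R * (clip 1 (xi i / tau) * a) =
   tau ^+ 2 / n%:R * (clip 1 (xi i / tau) * (a / tau)).
  by field; rewrite !lt0r_neq0.
have c0 : 0 <= tau ^+ 2 / n%:R by rewrite divr_ge0 ?sqr_ge0// ltW.
case: ifPn => hx.
  rewrite e1.
  have hx' : `|xi i / tau| <= 2^-1.
    by rewrite normrM normfV (gtr0_norm tau0) ler_pdivrMr// mulrC.
  have := ler_wpM2l c0 (huber_strong_tangent (a / tau) hx').
  lra.
have := ler_wpM2l c0 (huber_tangent (xi i / tau) (xi i / tau - a / tau)).
lra.
Qed.

Lemma norm1_support u : (0 < nnz beta)%N ->
  norm1 beta - norm1 (beta + u) <= 2 * Num.sqrt (nnz beta)%:R * norm2 u - norm1 u.
Proof.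
move=> s0; pose J := [set j | beta 0 j != 0]%SET.
have h1 : norm1 beta - norm1 (beta + u) <= 2 * \sum_(j in J) `|u 0 j| - norm1 u.
  rewrite [X in _ <= 2 * X - _]big_mkcond /norm1 mulr_sumr -!sumrB/=.
  apply: ler_sum => j _.
  rewrite mxE inE; case: ifPn => [_|/negPn/eqP ->].
    have := ler_normB (beta 0 j + u 0 j) (u 0 j); rewrite addrK.
    have := normr_ge0 (u 0 j); lra.
  by rewrite normr0 (add0r (u 0 j)); lra.
apply: (le_trans h1); rewrite lerD2r -mulrA ler_pM2l//.
rewrite -ler_sqr ?nnegrE ?sumr_ge0 ?mulr_ge0 ?sqrtr_ge0//.
apply: (le_trans (sum_norm_le _ _)); rewrite exprMn sqr_sqrtr// sqr_norm2.
apply: ler_wpM2l => //; rewrite [leRHS](bigID (mem J))/= lerDl.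
by apply: sumr_ge0 => j _; exact: sqr_ge0.
Qed.

End huber_lasso_facts.

(** * From bounds on the grid to the error bound *)

Section error_bound.
Context {R : realType} {n d : nat}.
Variables (X : 'I_n -> 'rV[R]_d).
Hypothesis (n0 : (0 < n)%N).

Let nR : 0 < n%:R :> R. Proof. by rewrite ltr0n. Qed.

(* The clipped values th_i of inner (X i) w are bounded by T, so Young's inequality
   bounds the linear form (1/n) sum_i th_i inner (X i) on the grid; by duality
   this controls its value at w, which dominates (1/n) sum_i th_i ^ 2. *)
Lemma mean_sqr_clip_le (T S nu : R) : 0 <= T -> 1 <= S -> 0 < nu ->
  (forall k : 'I_d -> int, norm2 (intvec k : 'rV[R]_d) ^+ 2 <= 4 * S ->
    n%:R^-1 * \sum_i huber_at T (inner (X i) ((nu / (2 * Num.sqrt S)) *: intvec k)) <= nu ^+ 2) ->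
  forall w, norm2 w + norm1 w / Num.sqrt S <= nu / 4 ->
  n%:R^-1 * \sum_i clip T (inner (X i) w) ^+ 2 <= 2 / 3 * nu ^+ 2.
Proof.
move=> T0 S1 nu0 HU w hw.
have S0 : 0 < S by lra.
have q0 : 0 < Num.sqrt S by rewrite sqrtr_gt0.
set B := n%:R^-1 * _.
have ni0 : 0 <= n%:R^-1 :> R by rewrite invr_ge0 ltW.
have B0 : 0 <= B by rewrite mulr_ge0// sumr_ge0// => i _; exact: sqr_ge0.
pose G : 'rV[R]_d := n%:R^-1 *: \sum_i clip T (inner (X i) w) *: X i.
have hG k : norm2 (intvec k : 'rV[R]_d) ^+ 2 <= 4 * S ->
    inner G (intvec k) <= Num.sqrt S * ((B / 2 + nu ^+ 2) * (2 / nu)).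
  move=> hk; have hU := HU k hk.
  have c0 : 0 < nu / (2 * Num.sqrt S) by rewrite divr_gt0// mulr_gt0.
  rewrite -(ler_pM2l c0) -innerZr.
  have -> : nu / (2 * Num.sqrt S) * (Num.sqrt S * ((B / 2 + nu ^+ 2) * (2 / nu))) = B / 2 + nu ^+ 2.
    by field; rewrite !lt0r_neq0.
  apply: le_trans (_ : B / 2 + _ <= _); last by rewrite lerD2l; exact: hU.
  rewrite /G inner_sumZl /B -mulrA -mulrDr ler_wpM2l// mulr_suml -big_split/=.
  apply: ler_sum => i _; apply: young_huber_at => //; exact: clip_norm.
have hGw := inner_le_of_grid S1 hG w.
have BG : B <= inner G w.
  rewrite /G inner_sumZl /B ler_wpM2l//; apply: ler_sum => i _; exact: sqr_clip_le.
have c0 : 0 <= (B / 2 + nu ^+ 2) * (2 / nu).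
  by apply: mulr_ge0; [apply: addr_ge0; [lra|exact: sqr_ge0]|rewrite divr_ge0// ltW].
(* The estimate is self-bounding: B <= inner G w <= B / 4 + nu^2 / 2, hence the factor 2/3. *)
have := ler_wpM2l c0 hw.
have -> : (B / 2 + nu ^+ 2) * (2 / nu) * (nu / 4) = (B / 2 + nu ^+ 2) / 2.
  by field; exact: lt0r_neq0.
lra.
Qed.

(** Each coordinate of the remainder is bounded both by h and by |u_j|; the product of the two
    bounds gives the dimension-free h |u|_1. The loss in the squared norm comes from (u_j - v_j)(u_j
    + v_j) <= 2 h |u_j|. *)
Lemma grid_rounding (h : R) (u : 'rV[R]_d) : 0 < h -> exists k : 'I_d -> int,
  let v := h *: intvec k in
  [/\ norm2 v <= norm2 u, norm2 u ^+ 2 - 2 * h * norm1 u <= norm2 v ^+ 2,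
      norm2 (v - u) ^+ 2 <= h * norm1 u & norm1 (v - u) <= norm1 u].
Proof.
move=> h0.
have /cid2-[k _ kP] : exists2 k : 'I_d -> int, True & forall j,
    `|(k j)%:~R| <= `|u 0 j / h| /\ `|u 0 j / h - (k j)%:~R| <= Num.min 1 `|u 0 j / h|.
  by have [k kP] := choice (fun j => round_toward0 (u 0 j / h)); exists k.
exists k; set v := h *: intvec k.
have vE j : v 0 j = h * (k j)%:~R by rewrite !mxE.
have uv j : u 0 j - v 0 j = h * (u 0 j / h - (k j)%:~R).
  by rewrite vE; field; exact: lt0r_neq0.
have hu j : h * `|u 0 j / h| = `|u 0 j|.
  by rewrite normrM normfV (gtr0_norm h0); field; exact: lt0r_neq0.
have v1 j : `|v 0 j| <= `|u 0 j|.
  by rewrite vE normrM (gtr0_norm h0) -hu ler_pM2l//; case: (kP j).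
have w1 j : `|u 0 j - v 0 j| <= h.
  rewrite uv normrM (gtr0_norm h0) ger_pMr//; case: (kP j) => _.
  by rewrite le_min => /andP[].
have w2 j : `|u 0 j - v 0 j| <= `|u 0 j|.
  rewrite uv normrM (gtr0_norm h0) -hu ler_pM2l//; case: (kP j) => _.
  by rewrite le_min => /andP[].
have uvE j : `|(v - u) 0 j| = `|u 0 j - v 0 j| by rewrite distrC !mxE.
split.
- rewrite -ler_sqr ?nnegrE ?norm2_ge0// !sqr_norm2; apply: ler_sum => j _.
  by rewrite -(real_normK (num_real (v 0 j))) -(real_normK (num_real (u 0 j))) ler_sqr.
- rewrite !sqr_norm2 mulr_sumr -sumrB; apply: ler_sum => j _.
  have h1 : (u 0 j - v 0 j) * (u 0 j + v 0 j) <= h * (2 * `|u 0 j|).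
    apply: (le_trans (ler_norm _)); rewrite normrM; apply: ler_pM => //.
    by apply: (le_trans (ler_normD _ _)); have := v1 j; lra.
  lra.
- rewrite sqr_norm2 /norm1 mulr_sumr; apply: ler_sum => j _.
  by rewrite -(real_normK (num_real _)) uvE expr2; apply: ler_pM.
- by rewrite /norm1; apply: ler_sum => j _; rewrite uvE.
Qed.

Variables (xi y : 'I_n -> R) (beta : 'rV[R]_d) (lambda_o lambda_s : R).
Hypotheses (lo0 : 0 < lambda_o) (ls0 : 0 < lambda_s)
  (yE : forall i, y i = inner (X i) beta + xi i) (s0 : (0 < nnz beta)%N).

Let tau := lambda_o * Num.sqrt n%:R.
Let s : R := (nnz beta)%:R.
Variables (A r S q al ga : R).

(** The part free of probability: the random inputs are three families of inequalities, each over
    finitely many integer vectors. *)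
Lemma huber_lasso_error_bound :
  (forall k : 'I_d -> int, norm2 (intvec k : 'rV[R]_d) ^+ 2 <= 4 * s ->
    inner (huber_gradient X xi lambda_o) (intvec k) <= Num.sqrt s * A) ->
  (forall k : 'I_d -> int, norm2 (intvec k : 'rV[R]_d) ^+ 2 <= 4 * S ->
    n%:R^-1 * \sum_i huber_at (tau / 2)
      (inner (X i) ((r / 20 / (2 * Num.sqrt S)) *: intvec k)) <= (r / 20) ^+ 2) ->
  (forall k : 'I_d -> int, let v : 'rV[R]_d := (r / (q * Num.sqrt s)) *: intvec k in
    norm2 v <= r -> al * norm2 v ^+ 2 - ga * r ^+ 2 <=
    n%:R^-1 * \sum_(i | `|xi i| <= tau / 2) clip (tau / 2) (inner (X i) v) ^+ 2) ->
  0 < r -> 3 * 160 ^+ 2 <= q -> 480 ^+ 2 * s <= S ->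
  999 / 1000 <= al -> ga <= 7 / 100 ->
  4 * (tau * A) <= lambda_s * Num.sqrt s ->
  2 * (4 * (tau * A) + 2 * (lambda_s * Num.sqrt s)) <= 4 / 5 * r ->
  forall b, argmin (huber_lasso lambda_o lambda_s X y) b ->
    norm1 (b - beta) <= 3 * Num.sqrt s * r /\ norm2 (b - beta) <= r.
Proof.
move=> HG HU HL r0 hq hS hal hga hcone hr b hb.
have tau0 : 0 < tau by rewrite mulr_gt0// sqrtr_gt0.
have s1 : 1 <= s by rewrite /s ler1n.
have sp : 0 < s by lra.
have S1 : 1 <= S by move: hS; rewrite expr2; lra.
have Sp : 0 < S by lra.
have qp : 0 < q by apply: lt_le_trans hq; rewrite mulr_gt0// exprn_gt0.
have ss0 : 0 < Num.sqrt s by rewrite sqrtr_gt0.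
have sS0 : 0 < Num.sqrt S by rewrite sqrtr_gt0.
have ssq : Num.sqrt s ^+ 2 = s by rewrite sqr_sqrtr// ltW.
have A0 : 0 <= A.
  have := HG (fun=> 0); rewrite sqr_norm2.
  rewrite big1 => [|j _]; last by rewrite mxE mulr0z expr0n.
  rewrite /inner big1 => [|j _]; last by rewrite [X in _ * X]mxE mulr0z mulr0.
  move=> hA; have {hA} : 0 <= Num.sqrt s * A by apply: hA; lra.
  by rewrite pmulr_rge0.
have gradb u : tau * inner (huber_gradient X xi lambda_o) u <=
    tau * A * (norm2 u + norm1 u / Num.sqrt s).
  by rewrite -mulrA ler_pM2l//; exact: inner_le_of_grid.
have basic u : huber_lasso lambda_o lambda_s X y (beta + u) <=
    huber_lasso lambda_o lambda_s X y beta ->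
  (n%:R^-1 * \sum_(i | `|xi i| <= tau / 2) clip (tau / 2) (inner (X i) u) ^+ 2) / 2 <=
  tau * A * (norm2 u + norm1 u / Num.sqrt s) +
  lambda_s * Num.sqrt s * (2 * norm2 u - norm1 u / Num.sqrt s).
  move=> /(huber_lasso_basic n0 lo0 yE) /le_trans; apply; apply: lerD => //.
  have -> : lambda_s * Num.sqrt s * (2 * norm2 u - norm1 u / Num.sqrt s) =
    lambda_s * (2 * Num.sqrt s * norm2 u - norm1 u) by field; exact: lt0r_neq0.
  by rewrite ler_pM2l//; exact: norm1_support.
set v := b - beta.
have Fv : huber_lasso lambda_o lambda_s X y (beta + v) <=
    huber_lasso lambda_o lambda_s X y beta.
  by rewrite /v addrC subrK; exact: hb.
have quad0 u : 0 <= (n%:R^-1 * \sum_(i | `|xi i| <= tau / 2) clip (tau / 2) (inner (X i) u) ^+ 2) / 2.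
  apply: divr_ge0 => //; apply: mulr_ge0; first by rewrite invr_ge0 ltW.
  by apply: sumr_ge0 => i _; exact: sqr_ge0.
(* As tau A is at most a quarter of lambda_s sqrt s, the right side of [basic] is at most lambda_s
   sqrt s times (9 |v|_2 - 3 |v|_1 / sqrt s) / 4, while the left side is nonnegative. *)
have cone : norm1 v / Num.sqrt s <= 3 * norm2 v.
  have h := le_trans (quad0 v) (basic v Fv).
  have v20 := norm2_ge0 v; have v10 : 0 <= norm1 v / Num.sqrt s.
    by rewrite divr_ge0 ?norm1_ge0// ltW.
  set a1 := norm1 v / _ in h v10 *; set a2 := norm2 v in h v20 *.
  have Lp : 0 < lambda_s * Num.sqrt s by rewrite mulr_gt0.
  have := ler_wpM2r (addr_ge0 v20 v10) hcone.
  move: (lambda_s * Num.sqrt s) (tau * A) Lp h => Lm At Lp h h'.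
  have : 0 <= Lm * (9 * a2 - 3 * a1) by lra.
  by rewrite pmulr_rge0//; lra.
have cone1 : norm1 v <= 3 * Num.sqrt s * norm2 v.
  by move: cone; rewrite ler_pdivrMr//; lra.
suff v2r : norm2 v <= r.
  split => //; apply: (le_trans cone1); rewrite ler_pM2l// mulr_gt0//.
rewrite leNgt; apply/negP => rv.
have v2p : 0 < norm2 v by exact: lt_trans rv.
pose th := r / norm2 v.
have th0 : 0 < th by rewrite divr_gt0.
have th1 : th <= 1 by rewrite ler_pdivrMr// mul1r ltW.
pose u := th *: v.
have Fu : huber_lasso lambda_o lambda_s X y (beta + u) <=
    huber_lasso lambda_o lambda_s X y beta.
  by apply: huber_lasso_convex => //; rewrite th1 ltW.
have u2 : norm2 u = r.
  by rewrite /u norm2Z (gtr0_norm th0) /th; field; exact: lt0r_neq0.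
have u1 : norm1 u <= 3 * Num.sqrt s * r.
  rewrite -u2 /u norm1Z norm2Z (gtr0_norm th0).
  by rewrite mulrCA ler_pM2l.
have u1' : norm1 u / Num.sqrt s <= 3 * r by rewrite ler_pdivrMr//; lra.
have u10 : 0 <= norm1 u / Num.sqrt s by rewrite divr_ge0 ?norm1_ge0// ltW.
have Zu : n%:R^-1 * (\sum_(i | `|xi i| <= tau / 2) clip (tau / 2) (inner (X i) u) ^+ 2) <= 4 / 5 * r ^+ 2.
  have := basic u Fu; rewrite u2.
  have h1 : tau * A * (r + norm1 u / Num.sqrt s) <= tau * A * (4 * r).
    by apply: ler_wpM2l; [rewrite mulr_ge0// ltW|lra].
  have Lp : 0 <= lambda_s * Num.sqrt s by rewrite mulr_ge0// ltW.
  have h2 : 0 <= lambda_s * Num.sqrt s * (norm1 u / Num.sqrt s) by rewrite mulr_ge0.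
  have := ler_wpM2r (ltW r0) hr; lra.
pose h := r / (q * Num.sqrt s).
have h0 : 0 < h by rewrite divr_gt0// mulr_gt0.
have [k [kv1 kv2 kw1 kw2]] := grid_rounding u h0.
set vv := h *: intvec k in kv1 kv2 kw1 kw2.
rewrite u2 in kv1 kv2.
have HLk := HL k kv1; rewrite -/h -/vv in HLk.
have hu1 : h * norm1 u <= 3 * r ^+ 2 / q.
  apply: (le_trans (ler_wpM2l (ltW h0) u1)); rewrite /h le_eqVlt; apply/orP; left; apply/eqP.
  by field; rewrite !lt0r_neq0.
have qi : 3 / q <= (160 ^+ 2)^-1.
  rewrite ler_pdivrMr// mulrC ler_pdivlMr ?exprn_gt0//; lra.
set w := vv - u in kw1 kw2.
(* The lower bounds on q and S are chosen so that |w|_2 and |w|_1 / sqrt S are each at most r/160;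
   together they make nu / 4 for nu = r/20, as [mean_sqr_clip_le] requires. *)
have w2 : norm2 w <= r / 160.
  rewrite -ler_sqr ?nnegrE ?norm2_ge0//; last by rewrite divr_ge0// ltW.
  apply: (le_trans kw1); apply: (le_trans hu1).
  have := ler_wpM2l (sqr_ge0 r) qi; rewrite exprMn exprVn; lra.
have w1 : norm1 w / Num.sqrt S <= r / 160.
  rewrite ler_pdivrMr//; apply: (le_trans kw2); apply: (le_trans u1).
  have : 480 * Num.sqrt s <= Num.sqrt S.
    have -> : 480 * Num.sqrt s = Num.sqrt (480 ^+ 2 * s).
      by rewrite sqrtrM ?exprn_ge0 ?ler0n// sqrtr_sqr ger0_norm ?ler0n.
    exact: ler_wsqrtr.
  move=> /(ler_wpM2l (ltW r0)); lra.
have nu0 : 0 < r / 20 by rewrite divr_gt0.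
have T0 : 0 <= tau / 2 by rewrite divr_ge0// ltW.
have Aw := mean_sqr_clip_le T0 S1 nu0 HU (w := w).
have {}Aw : n%:R^-1 * (\sum_i clip (tau / 2) (inner (X i) w) ^+ 2) <= 2 / 3 * (r / 20) ^+ 2.
  by apply: Aw; lra.
have Zv : n%:R^-1 * (\sum_(i | `|xi i| <= tau / 2) clip (tau / 2) (inner (X i) vv) ^+ 2) <=
   11 / 10 * (n%:R^-1 * (\sum_(i | `|xi i| <= tau / 2) clip (tau / 2) (inner (X i) u) ^+ 2)) +
   11 * (n%:R^-1 * (\sum_i clip (tau / 2) (inner (X i) w) ^+ 2)).
  rewrite mulrCA [X in _ <= _ + X]mulrCA -mulrDr ler_wpM2l ?invr_ge0 ?ler0n//.
  rewrite [leLHS]big_mkcond [X in _ <= _ * X + _]big_mkcond/=.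
  rewrite !mulr_sumr -big_split/=; apply: ler_sum => i _.
  case: ifP => _; last by rewrite mulr0 add0r mulr_ge0// sqr_ge0.
  have -> : vv = u + w by rewrite /w addrC subrK.
  by rewrite innerDr; exact: sqr_clipD.
(* The contradiction, in units of r^2: the lower bound at the grid point [vv] exceeds 0.92, while
   [Zv] allows at most 1.1 times 0.8 plus 11 times 2/1200, which is below 0.9. *)
have : 999 / 1000 * norm2 vv ^+ 2 <= al * norm2 vv ^+ 2 by rewrite ler_wpM2r// sqr_ge0.
have : ga * r ^+ 2 <= 7 / 100 * r ^+ 2 by rewrite ler_wpM2r// sqr_ge0.
have r2p : 0 < r ^+ 2 by rewrite exprn_gt0.
have := ler_wpM2l (sqr_ge0 r) qi.
move: HLk Zv Aw Zu kv2 hu1; rewrite exprMn.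
lra.
Qed.

End error_bound.

(** * Number of integer vectors in a ball *)

Section counting.
Context {R : realType}.

(** From exp(1/6) <= 6/5 and (6/5)^6 < 3. It gives log(d/s) >= 1 when d/s >= 3. *)
Lemma expR1_le3 : expR 1 <= 3 :> R.
Proof.
have h : 5 / 6 <= expR (- 6^-1) :> R by apply: le_trans (expR_ge1Dx _); lra.
have h1 : expR 6^-1 <= 6 / 5 :> R.
  by rewrite -[6^-1 : R]opprK expRN invf_ple ?posrE ?expR_gt0// invf_div.
have -> : 1 = 6%:R * 6^-1 :> R by field.
rewrite expRM_natl; apply: (@le_trans _ _ ((6 / 5) ^+ 6)).
  by apply: lerXn2r => //; rewrite nnegrE ?expR_ge0// divr_ge0.
by lra.
Qed.

(* The integer vectors with entries in [-N, N], as a finite type. *)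
Definition gridvec (d N : nat) (f : {ffun 'I_d -> 'I_(N + N).+1}) (j : 'I_d) : int :=
  (f j)%:Z - N%:Z.

(** For integers |k_j| <= k_j^2, so a box of half-width B already contains the ball of squared
    radius B. *)
Lemma gridvec_surj (d N : nat) (B : R) (k : 'I_d -> int) : B <= N%:R ->
  norm2 (intvec k : 'rV[R]_d) ^+ 2 <= B -> exists f, @gridvec d N f = k.
Proof.
rewrite sqr_norm2 => BN h.
have kN j : `|k j| <= N%:Z.
  have : (k j)%:~R ^+ 2 <= N%:R :> R.
    apply: le_trans BN; apply: le_trans h; rewrite (bigD1 j)//= mxE lerDl.
    by apply: sumr_ge0 => i _; exact: sqr_ge0.
  rewrite -[N%:R]/(N%:Z%:~R) -rmorphXn/= ler_int => h2.
  apply: le_trans h2; rewrite -[leRHS]ger0_norm ?sqr_ge0// normrX.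
  by case: (k j) => m; rewrite ?NegzE ?normrN /=; nia.
exists [ffun j => inord (absz (k j + N%:Z))]; apply/funext => j.
rewrite /gridvec ffunE inordK; have := kN j; rewrite ler_norml => /andP[h1 h2].
  by rewrite gez0_abs; lia.
by lia.
Qed.

Lemma sum_geometric_le (y : R) (N : nat) : 0 <= y -> y <= 3^-1 ->
  \sum_(i < N) y ^+ i.+1 <= 3 / 2 * y.
Proof.
move=> y0 y3.
have e : (1 - y) * \sum_(i < N) y ^+ i.+1 = y - y ^+ N.+1.
  elim: N => [|N IH]; first by rewrite big_ord0 mulr0 expr1 subrr.
  by rewrite big_ord_recr/= mulrDr IH [y ^+ N.+2]exprS; ring.
have s0 : 0 <= \sum_(i < N) y ^+ i.+1 by apply: sumr_ge0 => i _; exact: exprn_ge0.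
have yN : 0 <= y ^+ N.+1 by exact: exprn_ge0.
by nra.
Qed.

(** A truncated theta series: y^(m^2) <= y^m for m >= 1, and each of the two geometric tails is at
    most 3 y / 2. *)
Lemma sum_theta_le (y : R) (N : nat) : 0 <= y -> y <= 3^-1 ->
  \sum_(i < (N + N).+1) y ^+ (absz ((i%:Z - N%:Z) ^+ 2)) <= 1 + 3 * y.
Proof.
move=> y0 y3; have y1 : y <= 1 by lra.
have sq m : y ^+ (absz ((m%:Z) ^+ 2)) <= y ^+ m.
  by apply: ler_wiXn2l => //; rewrite abszX /=; nia.
rewrite -[(N + N).+1]addnS big_split_ord/= big_ord_recl/=.
have h0 : \sum_(i < N) y ^+ (absz ((i%:Z - N%:Z) ^+ 2)) <= 3 / 2 * y.
  apply: le_trans (sum_geometric_le N y0 y3).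
  rewrite (reindex_inj rev_ord_inj)/=; apply: ler_sum => i _.
  apply: le_trans (sq i.+1); rewrite le_eqVlt; apply/orP; left; apply/eqP.
  by congr (_ ^+ _); have := ltn_ord i; nia.
have h1 : \sum_(i < N) y ^+ (absz (((N + bump 0 i)%N%:Z - N%:Z) ^+ 2)) <= 3 / 2 * y.
  apply: le_trans (sum_geometric_le N y0 y3).
  apply: ler_sum => i _; apply: le_trans (sq i.+1).
  rewrite le_eqVlt; apply/orP; left; apply/eqP.
  by congr (_ ^+ _); rewrite /bump leq0n; nia.
rewrite addn0 subrr expr0n/= expr0.
lra.
Qed.

(** Exponential weighting with y = s/d: the indicator of the ball is at most y^(|k|^2 - Q s), and
    the weights factor over coordinates into a theta series to the power d, at most (1 + 3 s/d)^d <=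
    exp(3 s). Finally 3 s <= 3 s log(d/s). *)
Lemma card_grid_le (d s N : nat) (Q : R) : (0 < s)%N -> (0 < d)%N -> 3 <= d%:R / s%:R :> R ->
  \sum_(f : {ffun 'I_d -> 'I_(N + N).+1} |
     norm2 (intvec (gridvec f) : 'rV[R]_d) ^+ 2 <= Q * s%:R) 1 <=
  expR ((Q + 3) * (s%:R * ln (d%:R / s%:R))).
Proof.
move=> s0 d0 ds3; set l := ln _.
have sp : 0 < s%:R :> R by rewrite ltr0n.
have dp : 0 < d%:R :> R by rewrite ltr0n.
have dsp : 0 < d%:R / s%:R :> R by rewrite divr_gt0.
have l1 : 1 <= l.
  by rewrite -ler_expR lnK ?posrE//; apply: le_trans ds3; exact: expR1_le3.
pose y : R := s%:R / d%:R.
have yE : y = expR (- l) by rewrite expRN lnK ?posrE// invf_div.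
have y0 : 0 <= y by rewrite divr_ge0// ltW.
have y3 : y <= 3^-1.
  by rewrite -[y]invrK lef_pV2 ?posrE ?invr_gt0 ?divr_gt0// invf_div.
apply: (@le_trans _ _ (\sum_(f : {ffun 'I_d -> 'I_(N + N).+1})
   expR (l * (Q * s%:R)) * \prod_j y ^+ (absz (((f j)%:Z - N%:Z) ^+ 2)))).
  rewrite big_mkcond; apply: ler_sum => f _.
  case: ifPn => [hf|_]; last by rewrite mulr_ge0 ?expR_ge0// prodr_ge0// => j _; exact: exprn_ge0.
  have -> : \prod_j y ^+ (absz (((f j)%:Z - N%:Z) ^+ 2)) =
      expR (- l * norm2 (intvec (gridvec f) : 'rV[R]_d) ^+ 2).
    rewrite sqr_norm2 mulr_sumr expR_sum; apply: eq_bigr => j _.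
    rewrite yE -expRM_natl mxE /gridvec mulrC; congr (expR (_ * _)).
    by rewrite natr_absz ger0_norm ?sqr_ge0// rmorphXn.
  rewrite -expRD -[leLHS]expR0 ler_expR.
  have : 0 <= l * (Q * s%:R - norm2 (intvec (gridvec f) : 'rV[R]_d) ^+ 2).
    by rewrite mulr_ge0 ?subr_ge0//; lra.
  lra.
rewrite -mulr_sumr.
rewrite -(bigA_distr_bigA (fun (j : 'I_d) (i : 'I_(N + N).+1) =>
  y ^+ (absz ((i%:Z - N%:Z) ^+ 2)))) /=.
rewrite prodr_const card_ord.
have h3 : (\sum_(i < (N + N).+1) y ^+ (absz ((i%:Z - N%:Z) ^+ 2))) ^+ d <= expR (3 * s%:R).
  have -> : 3 * s%:R = d%:R * (3 * y) :> R by rewrite /y; field; exact: lt0r_neq0.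
  rewrite expRM_natl; apply: lerXn2r; rewrite ?nnegrE ?expR_ge0//.
    by apply: sumr_ge0 => i _; exact: exprn_ge0.
  by apply: (le_trans (sum_theta_le N y0 y3)); exact: expR_ge1Dx.
apply: (le_trans (ler_wpM2l (expR_ge0 _) h3)).
rewrite -expRD ler_expR.
have : 0 <= 3 * s%:R * (l - 1) by rewrite mulr_ge0 ?mulr_ge0 ?subr_ge0// ltW.
lra.
Qed.

End counting.

(** * Union bound over the grid *)

Section grid_union.
Context {disp : measure_display} {T : measurableType disp} {R : realType}.
Variable P : probability T R.
Variables (d s N : nat).
Hypotheses (s0 : (0 < s)%N) (d0 : (0 < d)%N) (ds3 : 3 <= d%:R / s%:R :> R).

(** Chernoff and union bound in one random variable: once the sum is below 1, every [Z f] lies below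
    its threshold [c f], so its mean is all that has to be bounded. *)
Lemma expectation_grid_sum_le (Q e : R) (Z : {ffun 'I_d -> 'I_(N + N).+1} -> T -> R)
    (c M : {ffun 'I_d -> 'I_(N + N).+1} -> R) :
  let cond f := norm2 (intvec (gridvec f) : 'rV[R]_d) ^+ 2 <= Q * s%:R in
  (forall f, measurable_fun setT (Z f)) ->
  (forall f, cond f -> 'E_P[fun w => expR (Z f w)] <= (expR (M f))%:E)%E ->
  (forall f, cond f -> (Q + 3) * (s%:R * ln (d%:R / s%:R)) + e <= c f - M f) ->
  ('E_P[fun w => (\sum_(f | cond f) expR (Z f w - c f))%R] <= (expR (- e))%:E)%E.
Proof.
move=> cond mZ hE hb.
have mY f : measurable_fun setT (fun w => expR (Z f w - c f)).
  by apply: measurableT_comp => //; exact: measurable_funB.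
rewrite expectationE.
under eq_integral do rewrite -big_filter -sumEFin.
rewrite ge0_integral_sum//; last by move=> f; exact/measurable_EFinP.
rewrite big_filter.
apply: (@le_trans _ _ (\sum_(f | cond f) (expR (- ((Q + 3) * (s%:R * ln (d%:R / s%:R)) + e)))%:E)%E).
  apply: lee_sum => f cf; rewrite -expectationE.
  have -> : (fun w => expR (Z f w - c f)) = (fun w => expR (- c f) * expR (Z f w)).
    by apply/funext => w; rewrite expRD mulrC.
  rewrite ge0_expectationZl ?expR_ge0//; last first.
    exact: measurableT_comp.
  apply: (@le_trans _ _ ((expR (- c f))%:E * (expR (M f))%:E)%E).
    by apply: lee_wpmul2l; [rewrite lee_fin expR_ge0|exact: hE].
  rewrite -EFinM lee_fin -expRD ler_expR; have := hb f cf; lra.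
rewrite sumEFin lee_fin.
have -> : \sum_(f | cond f) expR (- ((Q + 3) * (s%:R * ln (d%:R / s%:R)) + e)) =
    (\sum_(f | cond f) 1) * expR (- ((Q + 3) * (s%:R * ln (d%:R / s%:R)) + e)).
  by rewrite mulr_suml; apply: eq_bigr => f _; rewrite mul1r.
apply: (le_trans (ler_wpM2r (expR_ge0 _) (card_grid_le N Q s0 d0 ds3))).
by rewrite -expRD ler_expR; lra.
Qed.

(** Markov at level 1 for the sum of the three nonnegative variables. *)
Lemma markov_sum3 (S1 S2 S3 : T -> R) (e : R) :
  measurable_fun setT S1 -> measurable_fun setT S2 -> measurable_fun setT S3 ->
  (forall w, 0 <= S1 w) -> (forall w, 0 <= S2 w) -> (forall w, 0 <= S3 w) ->
  ('E_P[S1] <= e%:E -> 'E_P[S2] <= e%:E -> 'E_P[S3] <= e%:E ->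
  exists E : set T, [/\ measurable E, (1 - 3 * e)%:E <= P E &
    forall w, E w -> [/\ S1 w < 1, S2 w < 1 & S3 w < 1]%R])%E.
Proof.
move=> m1 m2 m3 p1 p2 p3 h1 h2 h3.
pose S w := S1 w + S2 w + S3 w.
have mS : measurable_fun setT S by apply: measurable_funD => //; exact: measurable_funD.
have ES : ('E_P[S] <= (3 * e)%:E)%E.
  rewrite /S ge0_expectationD//; last 2 first.
  - exact: measurable_funD.
  - by move=> w; rewrite addr_ge0.
  rewrite ge0_expectationD// (_ : 3 * e = e + e + e); last by ring.
  by rewrite !EFinD; apply: leeD => //; exact: leeD.
pose E := S @^-1` `]-oo, 1[%classic.
have mE : measurable E by rewrite -[X in measurable X]setTI; exact: mS.
exists E; split => //.
- rewrite -[E]setCK probability_setC; last exact: measurableC.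
  rewrite EFinB; apply: leeB => //; apply: le_trans ES.
  rewrite -expectation_indic; last exact: measurableC.
  apply: ge0_expectation_le => //; first exact/measurable_indic/measurableC.
  move=> w; rewrite indicE; case: (boolP (_ \in _)) => hw.
    by move: hw; rewrite inE /E /= in_itv /= => /negP; rewrite -leNgt.
  by rewrite /S !addr_ge0.
- move=> w; rewrite /E /= in_itv /= /S => h.
  have := p1 w; have := p2 w; have := p3 w; split; lra.
Qed.

End grid_union.

(* K is the sub-exponential constant used below, slightly larger than L; T0 is half
   the Huber threshold lambda_o sqrt n, r the radius r_2 and rho = r_ds + r_delta. *)
Section numerics.
Context {R : realType}.
Variables (n K L r T0 C rho : R).
Hypotheses (n0 : 0 < n) (L0 : 0 < L) (KE : K = 5 / 4 * L) (T00 : 0 < T0)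
  (rho0 : 0 < rho) (rho2 : rho <= 2) (K2 : 1 <= 2 * K ^+ 2)
  (C9 : 10 ^+ 9 <= C) (rE : r = 10 * L * T0 * C * rho)
  (hC : 320 * L ^+ 4 * C * rho <= 1).

Lemma num_C0 : 0 < C. Proof. by apply: lt_le_trans C9; rewrite exprn_gt0. Qed.

Lemma num_r0 : 0 < r.
Proof. by rewrite rE; do ?apply: mulr_gt0 => //; exact: num_C0. Qed.

Lemma num_L2 : 8 / 25 <= L ^+ 2.
Proof. by move: K2; rewrite KE exprMn; lra. Qed.

(** The sample-size condition [hC] in the form in which it is used: the radius is small against the
    truncation level. *)
Lemma num_rT : 32 * L ^+ 3 * r <= T0.
Proof.
have -> : 32 * L ^+ 3 * r = (320 * L ^+ 4 * C * rho) * T0 by rewrite rE; ring.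
by rewrite ger_pMl.
Qed.

Lemma num_K4 : K ^+ 4 = 625 / 256 * L ^+ 4.
Proof. by rewrite KE; field. Qed.

(** This [lam] makes the variance term n rho^2 and the gain 9 n rho^2; their difference is exactly
    (Q + 4) n rho^2, whence the constant 90. *)
Lemma num_gradient (sq Q lam : R) : 0 < sq -> Q = 4 ->
  lam = rho / (4 * (K * (2 * sq))) ->
  (Q + 4) * (n * rho ^+ 2) <=
  lam * (n * (sq * (90 * L * rho))) - n * (16 * lam ^+ 2 * (K * (2 * sq)) ^+ 2).
Proof.
move=> sq0 QE lamE; rewrite QE.
have K0 : 0 < K by rewrite KE mulr_gt0.
have -> : n * (16 * lam ^+ 2 * (K * (2 * sq)) ^+ 2) = n * rho ^+ 2.
  by rewrite lamE; field; rewrite !lt0r_neq0.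
have -> : lam * (n * (sq * (90 * L * rho))) = 9 * (n * rho ^+ 2).
  by rewrite lamE KE; field; rewrite !lt0r_neq0.
have : 0 <= n * rho ^+ 2 by rewrite mulr_ge0 ?sqr_ge0// ltW.
by lra.
Qed.

(** [lam] saturates lam T0 K nu <= 1/2. Of lam nu^2 = C rho / 5, the mean takes 1/2 and the
    second-order term at most 3/10; the remaining fifth beats (Q + 4) rho^2, with rho <= 2, if C >=
    50 (Q + 4), about 4.6 10^7. *)
Lemma num_huber (Q nu lam : R) : Q = 4 * 480 ^+ 2 -> nu = r / 20 ->
  lam = (2 * T0 * (K * nu))^-1 ->
  (Q + 4) * (n * rho ^+ 2) <=
  lam * (n * nu ^+ 2) - n * (lam * nu ^+ 2 / 2 + 192 * lam ^+ 2 * (K * nu) ^+ 4).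
Proof.
move=> QE nuE lamE; have K0 : 0 < K by rewrite KE mulr_gt0.
have r0 := num_r0; have nu0 : 0 < nu by rewrite nuE divr_gt0.
have lam0 : 0 < lam by rewrite lamE invr_gt0 !mulr_gt0.
have e2 : 96 * K ^+ 3 * nu / T0 <= 3 / 10.
  rewrite ler_pdivrMr//.
  have -> : 96 * K ^+ 3 * nu = 75 / 256 * (32 * L ^+ 3 * r) by rewrite nuE KE; field.
  by move: num_rT T00; lra.
have e3 : lam * nu ^+ 2 = C * rho / 5.
  by rewrite lamE nuE rE KE; field; rewrite !lt0r_neq0 ?num_C0.
have ln0 : 0 <= lam * nu ^+ 2 by rewrite mulr_ge0 ?sqr_ge0// ltW.
have e4 := ler_wpM2l ln0 e2.
have e1 : 192 * lam ^+ 2 * (K * nu) ^+ 4 = lam * nu ^+ 2 * (96 * K ^+ 3 * nu / T0).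
  by rewrite lamE; field; rewrite !lt0r_neq0.
rewrite e1 {e1}.
apply: (@le_trans _ _ (n * (lam * nu ^+ 2 / 5))); last first.
  have -> : lam * (n * nu ^+ 2) - n * (lam * nu ^+ 2 / 2 + lam * nu ^+ 2 * (96 * K ^+ 3 * nu / T0)) =
    n * (lam * nu ^+ 2 / 2 - lam * nu ^+ 2 * (96 * K ^+ 3 * nu / T0)).
    by field; exact: lt0r_neq0.
  by rewrite ler_pM2l//; move: ln0 e4; lra.
rewrite e3 [leLHS]mulrCA ler_pM2l// QE.
have : 50 * (4 * 480 ^+ 2 + 4) <= C by apply: le_trans C9; lra.
move=> /(ler_wpM2r (sqr_ge0 rho)).
have : C * rho ^+ 2 <= C * rho * 2.
  by rewrite expr2 mulrA ler_wpM2l// mulr_ge0// ltW// num_C0.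
lra.
Qed.

(** [lam] maximizes the bracket on the right. In the maximum 1 / (24 10^4 K^4) the radius has
    cancelled, so the smallness of rho given by [hC] has to compensate Q. *)
Lemma num_clip (Q t lam : R) : Q = (3 * 160 ^+ 2) ^+ 2 -> t = r ^+ 2 / 50 ->
  lam = t / (48 * (K * r) ^+ 4) ->
  (Q + 4) * (n * rho ^+ 2) <= n * (lam * t - 24 * lam ^+ 2 * (K * r) ^+ 4).
Proof.
move=> QE tE lamE; have K0 : 0 < K by rewrite KE mulr_gt0.
have r0 := num_r0.
have [D DE] : exists D : R, D = 24 * 10 ^+ 4 by eexists.
have Dp : 0 < D by rewrite DE mulr_gt0 ?exprn_gt0 ?ltr0n.
have -> : lam * t - 24 * lam ^+ 2 * (K * r) ^+ 4 = (D * K ^+ 4)^-1.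
  by rewrite DE lamE tE; field; rewrite !lt0r_neq0.
rewrite [leLHS]mulrCA ler_pM2l// num_K4.
have L2 := num_L2; have L20 := sqr_ge0 L.
have L4 : 64 / 625 <= L ^+ 4 by rewrite (exprM L 2 2); nra.
have L4p : 0 < L ^+ 4 by lra.
have D0 : 0 < D * (625 / 256 * L ^+ 4) by apply: mulr_gt0; [exact: Dp|move: L4p; lra].
rewrite -(ler_pM2r D0) mulVf; last exact: lt0r_neq0.
have hC2 : 320 ^+ 2 * (L ^+ 4 * L ^+ 4) * C ^+ 2 * rho ^+ 2 <= 1.
  have -> : 320 ^+ 2 * (L ^+ 4 * L ^+ 4) * C ^+ 2 * rho ^+ 2 = (320 * L ^+ 4 * C * rho) ^+ 2 by ring.
  rewrite expr_le1//; apply: mulr_ge0; last exact: ltW.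
  apply: mulr_ge0; last exact: ltW num_C0.
  by apply: mulr_ge0; [exact: ler0n|apply: exprn_ge0; exact: ltW].
apply: le_trans hC2.
have C2 : 10 ^+ 18 <= C ^+ 2.
  have -> : 10 ^+ 18 = (10 ^+ 9) ^+ 2 :> R by rewrite -exprM.
  by rewrite ler_sqr ?nnegrE ?exprn_ge0// ltW// num_C0.
have -> : (Q + 4) * rho ^+ 2 * (D * (625 / 256 * L ^+ 4)) =
  (L ^+ 4 * rho ^+ 2) * ((Q + 4) * (D * (625 / 256))) by ring.
have -> : 320 ^+ 2 * (L ^+ 4 * L ^+ 4) * C ^+ 2 * rho ^+ 2 =
  (L ^+ 4 * rho ^+ 2) * (320 ^+ 2 * (L ^+ 4 * C ^+ 2)) by ring.
apply: ler_wpM2l; first by rewrite mulr_ge0 ?sqr_ge0// ltW.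
apply: (@le_trans _ _ (320 ^+ 2 * (64 / 625 * 10 ^+ 18))).
  by rewrite QE DE; lra.
apply: ler_wpM2l; first exact: sqr_ge0.
apply: ler_pM; [lra| |exact: L4|exact: C2].
by apply: exprn_ge0; rewrite ler0n.
Qed.

(** In units of r^2, a truncation bias of at most 1/20 plus the deviation 1/50 allowed in the lower
    tail. *)
Lemma num_curvature : 6 * K ^+ 4 * r ^+ 2 / T0 ^+ 2 + 1 / 50 <= 7 / 100.
Proof.
have T2 : 0 < T0 ^+ 2 by exact: exprn_gt0.
suff : 6 * K ^+ 4 * r ^+ 2 / T0 ^+ 2 <= 1 / 20 by lra.
have r0 := num_r0.
rewrite ler_pdivrMr// num_K4.
have h : (32 * L ^+ 3 * r) ^+ 2 <= T0 ^+ 2.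
  rewrite ler_sqr ?nnegrE ?num_rT//; last exact: ltW.
  by apply: mulr_ge0; [apply: mulr_ge0; [lra|apply: exprn_ge0]|]; exact: ltW.
have h2 : 0 <= L ^+ 4 * r ^+ 2 by apply: mulr_ge0; apply: exprn_ge0; exact: ltW.
have := ler_wpM2l h2 num_L2.
lra.
Qed.

Lemma num_noise (sigma : R) : 0 < sigma -> 576 * sigma * L ^+ 2 <= 2 * T0 ->
  999 / 1000 <= 1 - sigma ^+ 2 / T0 ^+ 2.
Proof.
move=> sg0 hs; have T2 : 0 < T0 ^+ 2 by exact: exprn_gt0.
suff : sigma ^+ 2 / T0 ^+ 2 <= 1 / 1000 by lra.
rewrite ler_pdivrMr//.
have h1 : 288 * sigma * (8 / 25) <= T0.
  have := ler_wpM2l (ltW sg0) num_L2; lra.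
have h0 : 0 <= 288 * sigma * (8 / 25) by lra.
have : (288 * sigma * (8 / 25)) ^+ 2 <= T0 ^+ 2.
  by rewrite ler_sqr ?nnegrE//; exact: ltW.
have := sqr_ge0 sigma; lra.
Qed.

End numerics.

(** * Combination of the three random events *)

Lemma sum_expR_lt1 (R : realType) (I : finType) (c : pred I) (a : I -> R) i :
  \sum_(j | c j) expR (a j) < 1 -> c i -> a i < 0.
Proof.
move=> h ci; rewrite -expR_lt1; apply: le_lt_trans h.
by rewrite (bigD1 i)//= lerDl sumr_ge0// => j _; exact: expR_ge0.
Qed.

Lemma norm2_scale_le (R : realType) (d : nat) (v : 'rV[R]_d) (a nu B : R) :
  0 <= a -> 0 <= nu -> norm2 v ^+ 2 <= B -> a ^+ 2 * B <= nu ^+ 2 -> norm2 (a *: v) <= nu.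
Proof.
move=> a0 nu0 hv hB; rewrite norm2Z ger0_norm// -ler_sqr ?nnegrE ?mulr_ge0 ?norm2_ge0//.
by rewrite exprMn; apply: le_trans hB; rewrite ler_wpM2l ?sqr_ge0.
Qed.

Lemma norm2_delta (R : realType) (d : nat) (j : 'I_d) :
  norm2 (delta_mx 0 j : 'rV[R]_d) = 1.
Proof.
rewrite /norm2 (bigD1 j)//= big1 ?addr0; first by rewrite mxE !eqxx expr1n sqrtr1.
by move=> i ij; rewrite mxE (negbTE ij) andbF expr0n.
Qed.

(** Of the factor Q + 4, the size of the grid uses Q + 3; the last unit pays for the failure
    probability. *)
Lemma grid_exponent_le (R : realType) (Q sl ld nr b : R) : 0 <= Q -> 0 <= ld ->
  sl + ld <= nr -> (Q + 4) * nr <= b -> (Q + 3) * sl + (sl + ld) <= b.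
Proof.
move=> Q0 ld0 h; have Q4 : 0 <= Q + 4 by lra.
have Q3 : 0 <= Q + 3 by lra.
have := ler_wpM2l Q4 h; have := mulr_ge0 Q3 ld0; lra.
Qed.

Theorem theorem3p1 (R : realType) :
  exists C0 : R, 0 < C0 /\
  forall c1 c2 cs : R, C0 <= c1 -> C0 <= c2 -> 5 * c1 <= cs ->
  forall (n d s : nat), (0 < n)%N -> (0 < d)%N -> (0 < s)%N ->
    3 <= d%:R / s%:R :> R ->
  forall L sigma delta : R, 0 < L -> 0 < sigma -> 0 < delta -> delta < 1 ->
  forall beta_star : 'rV[R]_d, nnz beta_star = s ->
  forall (disp : measure_display) (T : measurableType disp)
    (P : probability T R)
    (x : 'I_n -> {RV P >-> d.-tuple R}) (xi : 'I_n -> {RV P >-> R})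
    (y : 'I_n -> T -> R),
    (forall i w, y i w = inner (vec (x i w)) beta_star + xi i w) ->
    iid P x ->
    (forall i, subexponential P L (x i)) ->
    (forall i, centered P (x i)) ->
    (forall i, isotropic P (x i)) ->
    iid P xi ->
    (forall i, 'E_P[fun w => (xi i w ^+ 2)%R] <= (sigma ^+ 2)%:E)%E ->
    independent_families P x xi ->
  let r_ds := Num.sqrt (s%:R * ln (d%:R / s%:R) / n%:R) in
  let r_delta := Num.sqrt (ln (1 / delta) / n%:R) in
  forall lambda_o lambda_s : R, 0 < lambda_o -> 0 < lambda_s ->
    576 * sigma * L ^+ 2 <= lambda_o * Num.sqrt n%:R ->
    lambda_s * Num.sqrt s%:R =
      cs * lambda_o * Num.sqrt n%:R * L * (r_ds + r_delta) ->
  let r2 := 5 * L * lambda_o * Num.sqrt n%:R * (c1 + c2 + cs)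
              * (r_ds + r_delta) in
  let r1 := 3 * Num.sqrt s%:R * r2 in
    Num.max (Num.max r_ds r_delta)
      (Num.max r2 (320 * L ^+ 4 * (c1 + c2 + cs) * (r_ds + r_delta))) <= 1 ->
  exists E : set T,
    [/\ measurable E, ((1 - 2 * delta)%:E <= P E)%E &
      forall w, E w -> forall beta_hat : 'rV[R]_d,
        argmin (huber_lasso lambda_o lambda_s
                  (fun i => vec (x i w)) (fun i => y i w)) beta_hat ->
        norm1 (beta_hat - beta_star) <= r1 /\
        norm2 (beta_hat - beta_star) <= r2].
Proof.
exists (10 ^+ 9); split; first by apply: exprn_gt0; rewrite ltr0n.
move=> c1 c2 cs hc1 hc2 hcs n d s n0 d0 s0 ds3 L sigma delta L0 sg0 dl0 dl1.
move=> beta hbeta disp T P x xi y yE [ix _] sx cx isox [ixi _] sxi ixxi r_ds r_delta.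
move=> lo ls lo0 ls0 hlo hls r2 r1.
rewrite !ge_max => /andP[/andP[rds1 rdl1] /andP[_ hC]].
have ten9 : 1000 <= 10 ^+ 9 :> R by lra.
set C := c1 + c2 + cs in r2 r1 hC *.
set rho := r_ds + r_delta in hls r2 r1 hC *.
have C9 : 10 ^+ 9 <= C.
  by rewrite /C; move: hc1 hc2 hcs ten9; move: (10 ^+ 9) => c0; lra.
have cs360 : 360 <= cs by move: hc1 hcs ten9; move: (10 ^+ 9) => c0; lra.
have C720 : 720 + 4 * cs <= 4 * C.
  by rewrite /C; move: hc1 hc2 hcs ten9; move: (10 ^+ 9) => c0; lra.
have nR : 0 < n%:R :> R by rewrite ltr0n.
have sR : 0 < s%:R :> R by rewrite ltr0n.
have s1 : 1 <= s%:R :> R by rewrite ler1n.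
set l := ln (d%:R / s%:R) in r_ds rds1 rho hls r2 r1 hC *.
have l1 : 1 <= l.
  rewrite -ler_expR lnK ?posrE; last by apply: lt_le_trans ds3.
  by apply: le_trans ds3; exact: expR1_le3.
have sl1 : 1 <= s%:R * l by rewrite -[1 in leLHS]mulr1 ler_pM.
set ld := ln (1 / delta) in r_delta rdl1 rho hls r2 r1 hC *.
have ld0 : 0 <= ld by apply: ln_ge0; rewrite ler_pdivlMr// mul1r ltW.
have rds0 : 0 < r_ds by rewrite sqrtr_gt0 divr_gt0//; lra.
have rdl0 : 0 <= r_delta by exact: sqrtr_ge0.
have rho0 : 0 < rho by rewrite ltr_wpDr.
have rho2 : rho <= 2 by rewrite /rho; lra.
have nrho : s%:R * l + ld <= n%:R * rho ^+ 2.
  have e1 : n%:R * r_ds ^+ 2 = s%:R * l.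
    rewrite sqr_sqrtr; first by field; exact: lt0r_neq0.
    by rewrite divr_ge0//; lra.
  have e2 : n%:R * r_delta ^+ 2 = ld.
    rewrite sqr_sqrtr; first by field; exact: lt0r_neq0.
    by rewrite divr_ge0.
  rewrite -e1 -e2 -mulrDr ler_pM2l// /rho.
  have : 0 <= r_ds * r_delta by rewrite mulr_ge0// ltW.
  lra.
have r4 : rho / 4 <= 2^-1 by lra.
pose e := s%:R * l + ld.
have nsl (Q b : R) : (Q + 4) * (n%:R * rho ^+ 2) <= b -> 0 <= Q ->
    (Q + 3) * (s%:R * l) + e <= b.
  move=> hb Q0; exact: (grid_exponent_le Q0 ld0 nrho hb).
(* As s log(d/s) >= 1 contributes a factor 1/2, the three events together fail with probability at
   most 3 delta / 2, within the allowed 2 delta. *)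
have e2 : expR (- e) <= delta / 2.
  rewrite /e opprD expRD.
  have -> : expR (- ld) = delta by rewrite expRN lnK ?posrE ?divr_gt0// invf_div divr1.
  rewrite [leLHS]mulrC; apply: ler_wpM2l; first exact: ltW.
  apply: (@le_trans _ _ (expR (- 1))); first by rewrite ler_expR lerN2.
  have h2 : 2 <= expR 1 :> R by apply: le_trans (expR_ge1Dx _); lra.
  by rewrite expRN lef_pV2 ?posrE ?expR_gt0.
pose tau := lo * Num.sqrt n%:R.
have tau0 : 0 < tau by rewrite mulr_gt0// sqrtr_gt0.
have [T0 T0E] : exists T0, T0 = tau / 2 by eexists.
have T00 : 0 < T0 by rewrite T0E divr_gt0.
have [K KE] : exists K, K = 5 / 4 * L by eexists.
have K0 : 0 < K by rewrite KE mulr_gt0.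
have LK : L < K by rewrite KE; lra.
have [r rr2] : exists r, r = r2 by eexists.
have rE : r = 10 * L * T0 * C * rho by rewrite rr2 /r2 T0E /tau; field.
have K2 : 1 <= 2 * K ^+ 2.
  pose i0 := Ordinal n0; pose v : 'rV[R]_d := delta_mx 0 (Ordinal d0).
  have v1 : norm2 v = 1 by exact: norm2_delta.
  have mv : measurable_fun setT (fun w => inner (vec (x i0 w)) v).
    exact: (measurableT_comp (measurable_inner v)).
  apply: (@sqr_moment_le _ _ _ P (fun w => inner (vec (x i0 w)) v) K mv K0).
    have vle : norm2 v <= 1 by rewrite v1.
    have := subexponential_expR (cx i0) (isox i0) (sx i0) ltr01 vle L0 LK.
    by rewrite mulr1.
  by rewrite expectation_inner_sqr// v1 expr1n.
have r0 : 0 < r by exact: (num_r0 L0 T00 rho0 C9 rE).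
pose q : R := 3 * 160 ^+ 2.
pose sq : R := Num.sqrt s%:R.
have sq0 : 0 < sq by rewrite sqrtr_gt0.
have sqq : sq ^+ 2 = s%:R by rewrite sqr_sqrtr// ltW.
pose S : R := 480 ^+ 2 * s%:R.
have S0 : 0 < S by apply: mulr_gt0; [apply: exprn_gt0; rewrite ltr0n|exact: sR].
have sS0 : 0 < Num.sqrt S by rewrite sqrtr_gt0.
have sSq : Num.sqrt S ^+ 2 = S by rewrite sqr_sqrtr// ltW.
(* One box serves the three grids, q^2 s being the largest of their squared radii. *)
have [N hN] : exists N : nat, q ^+ 2 * s%:R <= N%:R.
  by exists (Num.truncn (q ^+ 2 * s%:R)).+1; apply: ltW; exact: truncnS_gt.
pose kv (f : {ffun 'I_d -> 'I_(N + N).+1}) : 'rV[R]_d := intvec (gridvec f).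
have [nu nuE] : exists nu, nu = r / 20 by eexists.
have nu0 : 0 < nu by rewrite nuE divr_gt0.
have [t tE] : exists t, t = r ^+ 2 / 50 by eexists.
have [lam1 lam1E] : exists lam, lam = rho / (4 * (K * (2 * sq))) by eexists.
have [lam2 lam2E] : exists lam, lam = (2 * T0 * (K * nu))^-1 by eexists.
have [lam3 lam3E] : exists lam, lam = t / (48 * (K * r) ^+ 4) by eexists.
have lam1p : 0 < lam1 by rewrite lam1E divr_gt0// !mulr_gt0.
have lam2p : 0 < lam2 by rewrite lam2E invr_gt0 !mulr_gt0.
have lam3p : 0 < lam3 by rewrite lam3E tE !divr_gt0 ?mulr_gt0 ?exprn_gt0// mulr_gt0.
pose h (z : R) := clip 1 (z / tau).
have mh : measurable_fun setT h.
  by apply: (measurableT_comp (measurable_clip 1)); exact: measurable_funM.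
have h1 z : `|h z| <= 1 by exact: clip_norm.
have mlx i v : measurable_fun setT (fun w => inner (vec (x i w)) v).
  exact: (measurableT_comp (measurable_inner v)).
pose v2 f := (nu / (2 * Num.sqrt S)) *: kv f.
pose v3 f := (r / (q * sq)) *: kv f.
pose al := 1 - sigma ^+ 2 / T0 ^+ 2.
pose D := 6 * (K * r) ^+ 4 / T0 ^+ 2.
pose Z1 f w := lam1 * \sum_i h (xi i w) * inner (vec (x i w)) (kv f).
pose Z2 f w := lam2 * \sum_i huber_at T0 (inner (vec (x i w)) (v2 f)).
pose Z3 f w := - (lam3 * \sum_(i | `|xi i w| <= T0) clip T0 (inner (vec (x i w)) (v3 f)) ^+ 2).
pose a1 := lam1 * (n%:R * (sq * (90 * L * rho))).
pose a2 := lam2 * (n%:R * nu ^+ 2).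
(* Unlike [a1] and [a2], this threshold depends on the grid vector, as the lower bound is relative
   to its own norm; [t] is the deviation allowed. *)
pose a3 f := - (lam3 * (n%:R * (al * norm2 (v3 f) ^+ 2 - D - t))).
have mZ1 f : measurable_fun setT (Z1 f).
  apply: measurable_funM => //; apply: measurable_sum => i; apply: measurable_funM => //.
  exact: measurableT_comp.
have mZ2 f : measurable_fun setT (Z2 f).
  apply: measurable_funM => //; apply: measurable_sum => i.
  by apply: (measurableT_comp (measurable_huber_at T0)).
have mZ3 f : measurable_fun setT (Z3 f).
  apply: measurableT_comp => //; apply: measurable_funM => //.
  under eq_fun do rewrite big_mkcond/=.
  apply: measurable_sum => i; apply: measurable_fun_ifT => //.
    by apply: measurable_fun_ler => //; exact: measurableT_comp.
  by apply: measurable_funX; apply: (measurableT_comp (measurable_clip T0)).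
have E1 := @expectation_grid_sum_le _ _ _ P d s N s0 d0 ds3 4 e Z1 (fun=> a1)
  (fun=> n%:R * (16 * lam1 ^+ 2 * (K * (2 * sq)) ^+ 2)) mZ1.
have E2 := @expectation_grid_sum_le _ _ _ P d s N s0 d0 ds3 (4 * 480 ^+ 2) e Z2 (fun=> a2)
  (fun=> n%:R * (lam2 * nu ^+ 2 / 2 + 192 * lam2 ^+ 2 * (K * nu) ^+ 4)) mZ2.
have E3 := @expectation_grid_sum_le _ _ _ P d s N s0 d0 ds3 (q ^+ 2) e Z3 a3
  (fun f => n%:R * (- lam3 * (al * norm2 (v3 f) ^+ 2 - D) + 24 * lam3 ^+ 2 * (K * r) ^+ 4)) mZ3.
have v2le f : norm2 (kv f) ^+ 2 <= 4 * 480 ^+ 2 * s%:R -> norm2 (v2 f) <= nu.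
  move=> hf; apply: (norm2_scale_le _ _ hf); [|exact: ltW|].
    by rewrite divr_ge0 ?ltW// mulr_gt0.
  by rewrite -mulrA -/S exprMn exprVn exprMn sSq le_eqVlt; apply/orP; left; apply/eqP; field; exact: lt0r_neq0.
have q0 : 0 < q by apply: mulr_gt0; [|apply: exprn_gt0]; rewrite ltr0n.
have v3le f : norm2 (kv f) ^+ 2 <= q ^+ 2 * s%:R -> norm2 (v3 f) <= r.
  move=> hf; apply: (norm2_scale_le _ _ hf); [|exact: ltW|].
    by rewrite divr_ge0 ?ltW// mulr_gt0.
  rewrite exprMn exprVn exprMn sqq le_eqVlt; apply/orP; left; apply/eqP; field.
  by rewrite !lt0r_neq0.
have {}E1 : ('E_P[fun w => (\sum_(f | norm2 (kv f) ^+ 2 <= 4 * s%:R) expR (Z1 f w - a1))%R]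
    <= (expR (- e))%:E)%E.
  apply: E1 => [f hf|f _]; last first.
    apply: nsl => //; exact: (num_gradient nR L0 KE sq0 erefl lam1E).
  apply: (expectation_expR_gradient ix ixi ixxi sx cx isox L0 LK) => //.
  - exact: mulr_gt0.
  - rewrite -ler_sqr ?nnegrE ?norm2_ge0//; last by rewrite mulr_ge0// ltW.
    by rewrite exprMn sqq -natrX.
  - rewrite gtr0_norm// lam1E.
    have -> : rho / (4 * (K * (2 * sq))) * (K * (2 * sq)) = rho / 4.
      by field; rewrite !lt0r_neq0.
    exact: r4.
have {}E2 : ('E_P[fun w => (\sum_(f | norm2 (kv f) ^+ 2 <= 4 * 480 ^+ 2 * s%:R) expR (Z2 f w - a2))%R]
    <= (expR (- e))%:E)%E.
  apply: E2 => [f hf|f _]; last first.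
    apply: nsl; last by apply: mulr_ge0; [|apply: exprn_ge0]; exact: ler0n.
    exact: (num_huber nR L0 KE T00 rho0 rho2 C9 rE hC erefl nuE lam2E).
  apply: (expectation_expR_huber_at_sum ix ixi ixxi sx cx isox L0 LK) => //.
  - exact: ltW.
  - exact: ltW.
  - exact: v2le.
  - have -> : lam2 * T0 * (K * nu) = 2^-1 by rewrite lam2E; field; rewrite !lt0r_neq0.
    exact: lexx.
have {}E3 : ('E_P[fun w => (\sum_(f | norm2 (kv f) ^+ 2 <= q ^+ 2 * s%:R) expR (Z3 f w - a3 f))%R]
    <= (expR (- e))%:E)%E.
  apply: E3 => [f hf|f _]; last first.
    apply: nsl; last exact: sqr_ge0.
    apply: (le_trans (num_clip nR L0 KE T00 rho0 K2 C9 rE hC erefl tE lam3E)).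
    by rewrite /a3 le_eqVlt; apply/orP; left; apply/eqP; ring.
  apply: (expectation_expRN_clip_sum ix ixi ixxi sx cx isox L0 LK sxi) => //.
  - exact: ltW.
  - exact: v3le.
have mS (Q : R) (Z : _ -> T -> R) (a : _ -> R) : (forall f, measurable_fun setT (Z f)) ->
    measurable_fun setT (fun w => \sum_(f | norm2 (kv f) ^+ 2 <= Q * s%:R) expR (Z f w - a f)).
  move=> mZ; under eq_fun do rewrite -big_filter.
  apply: measurable_sum => f; apply: measurableT_comp => //; exact: measurable_funB.
have sum0 (Q : R) (Z : _ -> T -> R) (a : _ -> R) w :
    0 <= \sum_(f | norm2 (kv f) ^+ 2 <= Q * s%:R) expR (Z f w - a f).
  by apply: sumr_ge0 => f _; exact: expR_ge0.
have [E [mE PE HE]] := markov_sum3 (mS _ _ (fun=> a1) mZ1) (mS _ _ (fun=> a2) mZ2)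
  (mS _ _ a3 mZ3) (sum0 _ _ _) (sum0 _ _ _) (sum0 _ _ _) E1 E2 E3.
exists E; split => //.
  apply: le_trans PE; rewrite lee_fin lerD2l lerN2.
  apply: (@le_trans _ _ (3 * (delta / 2))); first by rewrite ler_wpM2l.
  by move: dl0; clear; lra.
move=> w Ew b hb; have [{}E1 {}E2 {}E3] := HE w Ew; rewrite /r1 -rr2.
have lift (B : R) (k : 'I_d -> int) : B <= q ^+ 2 * s%:R ->
    norm2 (intvec k : 'rV[R]_d) ^+ 2 <= B -> exists f, kv f = intvec k.
  move=> hB hk; have [f fk] := gridvec_surj (le_trans hB hN) hk.
  by exists f; rewrite /kv fk.
have q2 : 4 * 480 ^+ 2 <= q ^+ 2 by rewrite /q; clear; lra.
have q4 : 4 <= q ^+ 2 by rewrite /q; clear; lra.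
have W0 : 0 <= tau * (L * rho) by apply: mulr_ge0; [|apply: mulr_ge0]; exact: ltW.
have lsE : ls * sq = cs * (tau * (L * rho)) by rewrite /sq hls /tau; ring.
rewrite -hbeta.
apply: (huber_lasso_error_bound n0 lo0 ls0 (fun i => yE i w) _ (A := 90 * L * rho)
  (S := S) (q := q) (al := al) (ga := 6 * K ^+ 4 * r ^+ 2 / T0 ^+ 2 + 1 / 50)) => //.
all: rewrite ?hbeta -/sq -/tau -?T0E -?nuE.
- exact: s0.
- move=> k hk; have [f fk] := lift _ k (ler_wpM2r (ltW sR) q4) hk.
  rewrite -fk in hk *.
  have := sum_expR_lt1 E1 hk; rewrite subr_lt0 /Z1 /a1 ltr_pM2l// => /ltW hZ.
  rewrite /huber_gradient inner_sumZl -/tau -(ler_pM2l nR) mulrA mulfV ?mul1r//.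
  exact: lt0r_neq0.
- move=> k; rewrite /S mulrA => hk; have [f fk] := lift _ k (ler_wpM2r (ltW sR) q2) hk.
  rewrite -fk in hk *.
  have := sum_expR_lt1 E2 hk; rewrite subr_lt0 /Z2 /a2 ltr_pM2l// => /ltW hZ.
  rewrite -/S -/(v2 f) -(ler_pM2l nR) mulrA mulfV ?mul1r//.
  exact: lt0r_neq0.
- move=> k v hv.
  have hk : norm2 (intvec k : 'rV[R]_d) ^+ 2 <= q ^+ 2 * s%:R.
    have rq0 : 0 < r / (q * sq) by rewrite divr_gt0 ?mulr_gt0.
    rewrite -sqq -exprMn ler_sqr ?nnegrE ?norm2_ge0//; last by rewrite mulr_ge0// ltW.
    rewrite -(ler_pM2l rq0) -[X in X * _](gtr0_norm rq0) -norm2Z.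
    rewrite -[X in _ <= X](_ : r = _)//.
    by field; rewrite !lt0r_neq0.
  have [f fk] := lift _ k (lexx _) hk.
  rewrite {}/v -fk in hk hv *; rewrite -/(v3 f) in hv *.
  have := sum_expR_lt1 E3 hk; rewrite subr_lt0 /Z3 /a3 ltrN2 ltr_pM2l// => /ltW hZ.
  rewrite -(ler_pM2l nR) [X in _ <= X]mulrA mulfV ?mul1r; last exact: lt0r_neq0.
  apply: le_trans hZ; rewrite ler_pM2l// /D tE le_eqVlt; apply/orP; left; apply/eqP.
  by field; exact: lt0r_neq0.
- exact: lexx.
- apply: (num_noise KE T00 K2 sg0).
  have -> : 2 * T0 = lo * Num.sqrt n%:R by rewrite T0E /tau; field.
  exact: hlo.
- exact: (num_curvature L0 KE T00 rho0 K2 C9 rE hC).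
(* The cone condition reduces to 360 <= c_s, a consequence of c_s >= 5 c_1. *)
- rewrite lsE.
  have -> : 4 * (tau * (90 * L * rho)) = 360 * (tau * (L * rho)) by ring.
  exact: ler_wpM2r.
(* The factor 5 in r_2 makes 4/5 of it equal to 4 C tau L rho, so that c_1 + c_2 >= 180 suffices. *)
- rewrite lsE rr2 /r2.
  have -> : 2 * (4 * (tau * (90 * L * rho)) + 2 * (cs * (tau * (L * rho)))) =
    (720 + 4 * cs) * (tau * (L * rho)) by ring.
  have -> : 4 / 5 * (5 * L * lo * Num.sqrt n%:R * C * rho) = 4 * C * (tau * (L * rho)).
    by rewrite /tau; field.
  exact: ler_wpM2r.
Qed.
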